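(* Let $X$ be a real Hilbert space, let $f,g\colon X\to\,]-\infty,+\infty]$ be proper, lower semicontinuous, $\alpha$-convex and $\beta$-convex, respectively, and let $h\colon X\to\mathbb R$ be differentiable and convex with $\nabla h$ Lipschitz continuous with constant $1/\sigma$ ($\sigma>0$). Let $\gamma,\delta,\eta>0$ and suppose that either (a) $\alpha+\beta=0$, $1+2\gamma\alpha>0$, $\delta=\frac{\gamma}{1+2\gamma\alpha}$, and $\eta^*:=2+2\gamma\alpha-\frac{\gamma}{2\sigma}>0$; or (b) $\alpha+\beta>0$ and $\eta^*:=\frac{4\gamma\delta(1+\gamma\alpha)(1+\delta\beta)-(\gamma+\delta)^2}{2\gamma\delta^2(\alpha+\beta)}-\frac{\gamma}{2\sigma}>0$. Set $\lambda:=1+\frac\delta\gamma$, $S:=(1-\lambda)\mathrm{Id}+\lambda\operatorname{Prox}_{\gamma f}-\delta\nabla h\operatorname{Prox}_{\gamma f}$, and $$T_{f,g,h}:=\mathrm{Id}-\eta\operatorname{Prox}_{\gamma f}+\eta\operatorname{Prox}_{\delta g}S.$$ Let $x_0\in X$ and $x_{n+1}:=T_{f,g,h}x_n$. Then: (i) $T_{f,g,h}$ is single-valued, has full domain, and is conically $\frac{\eta}{\eta^*}$-averaged. (ii) If $\operatorname{zer}(\widehat\partial f+\widehat\partial g+\nabla h)\neq\varnothing$ and $\eta<\eta^*$, then $\|x_n-T_{f,g,h}x_n\|=o(1/\sqrt n)$, $(x_n)$ converges weakly to some $x^*\in\operatorname{Fix}T_{f,g,h}$ with $\operatorname{Prox}_{\gamma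 f}x^*\in\operatorname{zer}(\widehat\partial f+\widehat\partial g+\nabla h)\subseteq\operatorname{argmin}(f+g+h)$, $(\nabla h\operatorname{Prox}_{\gamma f}x_n)$ converges strongly to $\nabla h\operatorname{Prox}_{\gamma f}x^*$, and $\nabla h(\operatorname{zer}(\widehat\partial f+\widehat\partial g+\nabla h))=\{\nabla h\operatorname{Prox}_{\gamma f}x^*\}$. Moreover, under (a), $(\operatorname{Prox}_{\gamma f}x_n)$ and $(\operatorname{Prox}_{\delta g}Sx_n)$ converge weakly to $\operatorname{Prox}_{\gamma f}x^*=\operatorname{Prox}_{\delta g}Sx^*$; under (b), they converge strongly to $\operatorname{Prox}_{\gamma f}x^*=\operatorname{Prox}_{\delta g}Sx^*$ and $\operatorname{zer}(\widehat\partial f+\widehat\partial g+\nabla h)=\{\operatorname{Prox}_{\gamma f}x^*\}$.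
   Context: A function $f\colon X\to\,]-\infty,+\infty]$ is proper if $\operatorname{dom}f:=\{x:f(x)<+\infty\}\ne\varnothing$; it is $\alpha$-convex ($\alpha\in\mathbb R$) if $f((1-\kappa)x+\kappa y)+\frac\alpha2\kappa(1-\kappa)\|x-y\|^2\le(1-\kappa)f(x)+\kappa f(y)$ for all $x,y\in\operatorname{dom}f$, $\kappa\in(0,1)$. The Fréchet subdifferential is $\widehat\partial f(x):=\{u\in X:\liminf_{z\to x}\frac{f(z)-f(x)-\langle u,z-x\rangle}{\|z-x\|}\ge0\}$. The proximity operator is $\operatorname{Prox}_{\gamma f}(x):=\operatorname{argmin}_{z\in X}\big(f(z)+\frac1{2\gamma}\|z-x\|^2\big)$. $\operatorname{zer}A:=\{x:0\in Ax\}$, $\operatorname{Fix}T=\{x:Tx=x\}$. $T$ is conically $\theta$-averaged ($\theta>0$) if $T=(1-\theta)\mathrm{Id}+\theta N$ for some nonexpansive $N$. *)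

(* Defs.v *)
From HB Require Import structures.
From mathcomp Require Import all_boot all_order all_algebra.
From mathcomp Require Import all_classical all_reals all_analysis.
Set Implicit Arguments. Unset Strict Implicit. Unset Printing Implicit Defensive.
Import Order.TTheory GRing.Theory Num.Theory.
Import numFieldNormedType.Exports.
Local Open Scope classical_set_scope.
Local Open Scope ring_scope.

Section Hilbert.
Context {R : realType} {V : normedModType R}.

(* ip is an inner product on V inducing the norm of V.  Together with
   completeness of V this makes V a real Hilbert space. *)
Definition inner_product (ip : V -> V -> R) : Prop :=
  [/\ forall x y, ip x y = ip y x,
      forall (a : R) x y z, ip (a *: x + y) z = a * ip x z + ip y z
    & forall x, `|x| ^+ 2 = ip x x].

Definition proper_fun (f : V -> \bar R) : Prop :=
  (forall x, f x != -oo%E) /\ exists x, (f x < +oo)%E.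

Definition alpha_convex (alpha : R) (f : V -> \bar R) : Prop :=
  forall x y, (f x < +oo)%E -> (f y < +oo)%E -> forall k : R, 0 < k < 1 ->
    (f ((1 - k) *: x + k *: y)%R + (alpha / 2 * k * (1 - k) * `|x - y| ^+ 2)%R%:E
      <= (1 - k)%R%:E * f x + k%:E * f y)%E.

Definition convex_fun (h : V -> R) : Prop :=
  forall x y (k : R), 0 < k < 1 ->
    h ((1 - k) *: x + k *: y) <= (1 - k) * h x + k * h y.

Definition is_gradient (ip : V -> V -> R) (h : V -> R) (G : V -> V) : Prop :=
  forall x, differentiable h x /\ forall v, 'd h x v = ip (G x) v.

Definition lipschitz_with (L : R) (G : V -> V) : Prop :=
  forall x y, `|G x - G y| <= L * `|x - y|.

Definition nonexpansive (N : V -> V) : Prop := lipschitz_with 1 N.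

(* Frechet subdifferential: u \in frechet_subdiff f x iff f x is finite and
   liminf_{z->x} (f z - f x - <u, z-x>)/|z-x| >= 0, i.e. for every eps > 0,
   eventually f z >= f x + <u,z-x> - eps |z - x|. *)
Definition frechet_subdiff (ip : V -> V -> R) (f : V -> \bar R) (x : V) : set V :=
  [set u | f x \is a fin_num /\
     forall eps : R, 0 < eps -> \forall z \near x,
       ((fine (f x) + ip u (z - x) - eps * `|z - x|)%R%:E <= f z)%E].

Definition prox (gamma : R) (f : V -> \bar R) (x : V) : set V :=
  [set p | forall z, (f p + (`|p - x| ^+ 2 / (2 * gamma))%R%:E
                       <= f z + (`|z - x| ^+ 2 / (2 * gamma))%R%:E)%E].

Definition zer_sum (ip : V -> V -> R) (f g : V -> \bar R) (G : V -> V) : set V :=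
  [set x | exists u v, frechet_subdiff ip f x u /\ frechet_subdiff ip g x v
                       /\ u + v + G x = 0].

(* S x, evaluated with p standing for Prox_{gamma f} x:
   S = (1 - lambda) Id + lambda Prox_{gamma f} - delta (grad h) Prox_{gamma f},
   lambda = 1 + delta/gamma *)
Definition S_op (gamma delta : R) (G : V -> V) (p x : V) : V :=
  (1 - (1 + delta / gamma)) *: x + (1 + delta / gamma) *: p - delta *: G p.

Definition T_op (gamma delta eta : R) (f g : V -> \bar R) (G : V -> V) (x : V)
  : set V :=
  [set y | exists p q, prox gamma f x p /\ prox delta g (S_op gamma delta G p x) q
                       /\ y = x - eta *: p + eta *: q].

Definition conically_averaged (theta : R) (T : V -> set V) : Prop :=
  0 < theta /\ exists N : V -> V, nonexpansive N /\
    forall x, T x = [set (1 - theta) *: x + theta *: N x].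

Definition weak_cvg (ip : V -> V -> R) (u : nat -> V) (x : V) : Prop :=
  forall y, (fun n => ip (u n) y) @ \oo --> ip x y.

End Hilbert.

Definition cond_a {R : realType} (alpha beta sigma gamma delta etastar : R) : Prop :=
  [/\ alpha + beta = 0, 0 < 1 + 2 * gamma * alpha,
      delta = gamma / (1 + 2 * gamma * alpha)
    & etastar = 2 + 2 * gamma * alpha - gamma / (2 * sigma)].

Definition cond_b {R : realType} (alpha beta sigma gamma delta etastar : R) : Prop :=
  (0 < alpha + beta) /\
  (etastar = (4 * gamma * delta * (1 + gamma * alpha) * (1 + delta * beta)
              - (gamma + delta) ^+ 2) / (2 * gamma * delta ^+ 2 * (alpha + beta))
            - gamma / (2 * sigma)).

(* Main.v *)
(* Each proximity operator is the inverse of a strongly monotone operator and grad h is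
   cocoercive (Baillon-Haddad). Adding the three monotonicity inequalities between two
   steps (x, p, q), (x', p', q') of the algorithm bounds <x - x', r>, with
   r = (p - q) - (p' - q'), below by a quadratic form; its best comparison with |r|^2
   yields etastar/2 |r|^2 <= <x - x', r>, i.e. N = Id - etastar (P - QS) is nonexpansive.
   The same inequalities control grad h p - grad h p' and, when alpha + beta > 0,
   p - p' itself by r, which gives the strong convergences once r -> 0.
   Weak convergence of the Krasnoselskii-Mann iterates avoids weak compactness: all
   cofinal subfamilies of the iterates share one asymptotic center (the minimizer of
   limsup |x n - y|^2), and that center is the weak limit. Proximal points and asymptotic
   centers both come from one minimization principle for strongly convex functions. *)
Require Import Defs.
From HB Require Import structures.
From mathcomp Require Import all_boot all_order all_algebra.
From mathcomp Require Import all_classical all_reals all_analysis.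
From mathcomp Require Import ring lra.
Import Order.TTheory GRing.Theory Num.Theory.
Import numFieldNormedType.Exports.
Local Open Scope classical_set_scope.
Local Open Scope ring_scope.
Set Implicit Arguments. Unset Strict Implicit. Unset Printing Implicit Defensive.

(** * Algebra of the inner product *)

Section InnerProduct.
Context {R : realType} {V : normedModType R} {ip : V -> V -> R}.
Hypothesis ipP : inner_product ip.
Implicit Types x y z : V.

Lemma ipC x y : ip x y = ip y x.
Proof. by case: ipP => + _ _; apply. Qed.

Lemma sqr_normE x : `|x| ^+ 2 = ip x x.
Proof. by case: ipP => _ _; apply. Qed.

Lemma ip0l y : ip 0 y = 0.
Proof.
case: ipP => _ lin _; have := lin 1 0 0 y.
by rewrite scaler0 addr0 mul1r => h; lra.
Qed.

Lemma ipZl a x y : ip (a *: x) y = a * ip x y.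
Proof. by case: ipP => _ lin _; rewrite -[a *: x]addr0 lin ip0l addr0. Qed.

Lemma ipDl x y z : ip (x + y) z = ip x z + ip y z.
Proof. by case: ipP => _ lin _; rewrite -[x]scale1r lin mul1r scale1r. Qed.

Lemma ipNl x y : ip (- x) y = - ip x y.
Proof. by rewrite -scaleN1r ipZl mulN1r. Qed.

Lemma ipZr a x y : ip x (a *: y) = a * ip x y.
Proof. by rewrite ipC ipZl ipC. Qed.

Lemma ipDr x y z : ip x (y + z) = ip x y + ip x z.
Proof. by rewrite ipC ipDl !(ipC x). Qed.

Lemma ipNr x y : ip x (- y) = - ip x y.
Proof. by rewrite ipC ipNl ipC. Qed.

Definition ipE := (ipDl, ipDr, ipNl, ipNr, ipZl, ipZr).

Lemma ip_ge0 x : 0 <= ip x x.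
Proof. by rewrite -sqr_normE sqr_ge0. Qed.

(** Squaring the triangle inequality of the norm and cancelling the squares leaves
    Cauchy-Schwarz. *)
Lemma ip_le_norm x y : ip x y <= `|x| * `|y|.
Proof.
have := ler_normD x y; rewrite -(@ler_pXn2r _ 2%N) ?nnegrE ?addr_ge0 //.
rewrite sqr_normE !ipE (ipC y x) -!sqr_normE; nra.
Qed.

(** Expand [|t x - y|^2 >= 0] and divide by [2 t]. *)
Lemma ip_young (t : R) x y : 0 < t -> ip x y <= t / 2 * ip x x + ip y y / (2 * t).
Proof.
move=> t0; have := ip_ge0 (t *: x - y); rewrite !ipE (ipC y x) => h.
rewrite -(ler_pM2l t0).
have -> : t * (t / 2 * ip x x + ip y y / (2 * t)) = (t ^+ 2 * ip x x + ip y y) / 2.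
  by field; rewrite gt_eqF.
nra.
Qed.

Lemma sqr_norm_conv (k : R) x y :
  `|(1 - k) *: x + k *: y| ^+ 2 =
  (1 - k) * `|x| ^+ 2 + k * `|y| ^+ 2 - k * (1 - k) * `|x - y| ^+ 2.
Proof. by rewrite !sqr_normE !ipE (ipC y x); ring. Qed.

End InnerProduct.

(** * Elementary limit arguments *)

Section Cvg.
Context {R : realType} {V : normedModType R}.

Lemma cvg_sqr_dist (u : nat -> V) (l : V) (w : nat -> R) :
  (forall n, `|u n - l| ^+ 2 <= w n) -> w @ \oo --> 0 -> u @ \oo --> l.
Proof.
move=> uw w0; apply/cvgrPdist_lt => e e0.
have e20 : 0 < e ^+ 2 by rewrite exprn_gt0.
have /cvgrPdist_lt /(_ _ e20) := w0; apply: filterS => n /=.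
rewrite sub0r normrN => wn; rewrite distrC -(@ltr_pXn2r _ 2%N) ?nnegrE //; last exact: ltW.
exact: le_lt_trans (uw n) (le_lt_trans (ler_norm _) wn).
Qed.

(** Packages the passage [k -> 0+] used after dividing a convexity inequality by [k]; if [b < a],
    any small [k < (a - b) / (|c| + 1)] is contradictory. *)
Lemma ler_addgt0_lin (a b c k0 : R) : 0 < k0 ->
  (forall k, 0 < k < k0 -> a <= b + k * c) -> a <= b.
Proof.
move=> k00 h; rewrite leNgt; apply/negP => ba.
have nc := normr_ge0 c; have lc := ler_norm c.
have c0 : 0 < `|c| + 1 by lra.
pose k1 := (a - b) / (`|c| + 1).
have k10 : 0 < k1 by rewrite divr_gt0 ?subr_gt0.
pose k := Num.min k0 k1 / 2.
have kmin : 0 < Num.min k0 k1 by rewrite lt_min k00.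
have [kk0 kk1] : k < k0 /\ k < k1.
  have : Num.min k0 k1 <= k0 by rewrite ge_min lexx.
  have : Num.min k0 k1 <= k1 by rewrite ge_min lexx orbT.
  by rewrite /k; lra.
have kpos : 0 < k by rewrite divr_gt0.
have := h k; rewrite kpos kk0 => /(_ isT) abk.
have : k * c <= k * `|c| by rewrite ler_pM2l.
have : k * (`|c| + 1) < a - b by rewrite -ltr_pdivlMr.
lra.
Qed.

End Cvg.

(** * Minimization of strongly convex functions *)

Section StronglyConvex.
Context {R : realType} {X : completeNormedModType R}.

(* [E y a] is read as "F y <= a" for a [mu]-strongly convex function [F];
   working with this relation avoids extended-real values and limsups. *)
Definition strongly_convex_epi (mu : R) (E : X -> R -> Prop) : Prop :=
  forall y a z b k, 0 < k < 1 -> E y a -> E z b ->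
    E ((1 - k) *: y + k *: z)
      ((1 - k) * a + k * b - mu / 2 * k * (1 - k) * `|y - z| ^+ 2).

(** Strong convexity at midpoints makes a minimizing sequence Cauchy; its limit is a minimizer by
    the closedness hypothesis. Quadratic growth follows by comparing [c] with points of the segment
    towards [y] that approach [c]. *)
Lemma strongly_convex_min (E : X -> R -> Prop) (mu lb : R) : 0 < mu ->
  strongly_convex_epi mu E -> (exists y a, E y a) ->
  (forall (y : X) (a : R), E y a -> lb <= a) ->
  (forall (c : X) (m : R), (forall e : R, 0 < e -> exists (y : X) (a : R), [/\ `|y - c| < e, a < m + e & E y a]) ->
     forall e : R, 0 < e -> E c (m + e)) ->
  exists (c : X) (m : R), (forall e : R, 0 < e -> E c (m + e)) /\
    forall (y : X) (a : R), E y a -> m + mu / 2 * `|y - c| ^+ 2 <= a.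
Proof.
move=> mu0 Ecvx [y0 [a0 E0]] Elb Ecl.
pose S : set R := [set a | exists y, E y a].
have Slb : has_lbound S by exists lb => a [y /Elb].
have Sinf : has_inf S by split => //; exists a0, y0.
pose m := inf S.
have mE y a : E y a -> m <= a by move=> Ey; apply: ge_inf => //; exists y.
have /choice[u uP] : forall n, exists w, E w.1 w.2 /\ w.2 < m + harmonic n.
  move=> n; have [|a [y Ey] am] := @inf_adherent _ S (harmonic n) _ Sinf.
    by rewrite /= invr_gt0.
  by exists (y, a).
(* The midpoint has value at least [m], while strong convexity puts it [mu / 8] times the squared
   distance below the average of two nearly minimal values. *)
have dist i j : `|(u i).1 - (u j).1| ^+ 2 <= 4 / mu * (harmonic i + harmonic j).
  have [Ei ai] := uP i; have [Ej aj] := uP j.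
  have k01 : 0 < (2^-1 : R) < 1 by apply/andP; split; lra.
  have := mE _ _ (Ecvx _ _ _ _ _ k01 Ei Ej).
  set d := `|_| ^+ 2 => mle.
  rewrite -(ler_pM2l mu0).
  have -> : mu * (4 / mu * (harmonic i + harmonic j)) = 4 * (harmonic i + harmonic j).
    by field; rewrite gt_eqF.
  lra.
have cvgu : cvg ((fun n => (u n).1) @ \oo).
  apply/cauchy_cvgP; apply: cauchy_exP => e e0.
  (* Two harmonic terms below this threshold turn the bound [dist] into [e ^+ 2]. *)
  have eta0 : 0 < mu * e ^+ 2 / 8 by rewrite divr_gt0 ?mulr_gt0 ?exprn_gt0.
  have /cvgrPdist_lt /(_ _ eta0) [N _ hN] := @cvg_harmonic R.
  have hlt n : (N <= n)%N -> harmonic n < mu * e ^+ 2 / 8.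
    by move=> /hN /=; rewrite sub0r normrN; apply: le_lt_trans (ler_norm _).
  exists (u N).1; exists N => // n /= Nn; rewrite -ball_normE /=.
  rewrite -(@ltr_pXn2r _ 2%N) ?nnegrE //; last exact: ltW.
  apply: (le_lt_trans (dist _ _)); rewrite -(ltr_pM2l mu0).
  have -> : mu * (4 / mu * (harmonic N + harmonic n)) = 4 * (harmonic N + harmonic n).
    by field; rewrite gt_eqF.
  have := hlt _ (leqnn N); have := hlt _ Nn; lra.
pose c := lim ((fun n => (u n).1) @ \oo).
have Ec e : 0 < e -> E c (m + e).
  apply: Ecl => {}e e0.
  have /cvgrPdist_lt /(_ _ e0) near1 : (fun n => (u n).1) @ \oo --> c by [].
  have /cvgrPdist_lt /(_ _ e0) near2 := @cvg_harmonic R.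
  have [n [/= un hn]] := filter_ex (filterI near1 near2).
  exists (u n).1, (u n).2; have [En an] := uP n; split => //.
  - by rewrite distrC.
  - apply: (lt_trans an); rewrite ltrD2l; move: hn; rewrite sub0r normrN.
    exact: le_lt_trans (ler_norm _).
exists c, m; split => // y a Ey.
apply: (@ler_addgt0_lin _ _ _ (mu / 2 * `|y - c| ^+ 2) 1) => // k k01.
have /andP[k0 k1] := k01.
rewrite -(ler_pM2l k0).
apply/ler_addgt0Pr => e e0.
have := mE _ _ (Ecvx _ _ _ _ _ k01 (Ec _ e0) Ey).
rewrite distrC; set d := `|_| ^+ 2.
have : 0 < k * e by rewrite mulr_gt0.
lra.
Qed.

(** A far point cannot have a very low value: the point of the segment at distance [r / 2] from [y0]
    would fall below [l]. The resulting lower bound loses at most [K d], linear in the distance [d],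
    and the quadratic gain in [d] absorbs it. *)
Lemma strongly_convex_bounded_below (E : X -> R -> Prop) (mu r l a0 : R) (y0 : X) :
  0 < mu -> 0 < r -> strongly_convex_epi mu E -> E y0 a0 ->
  (forall (y : X) (a : R), `|y - y0| < r -> E y a -> l <= a) ->
  exists lb : R, forall (y : X) (a : R), E y a -> lb <= a.
Proof.
move=> mu0 r0 Ecvx E0 near_y0.
have la0 : l <= a0 by apply: near_y0 E0; rewrite subrr normr0.
pose K := 2 * (a0 - l) / r.
have K0 : 0 <= K by rewrite divr_ge0 ?mulr_ge0 ?subr_ge0 // ltW.
have Kmu : 0 <= K ^+ 2 / mu by rewrite divr_ge0 ?sqr_ge0 // ltW.
exists (l - K ^+ 2 / mu) => y a Ey.
have [yr|ry] := ltP `|y - y0| r.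
  by have := near_y0 _ _ yr Ey; lra.
set d := `|y - y0| in ry.
have d0 : 0 < d by exact: lt_le_trans ry.
(* This ratio places the test point at distance [r / 2] from [y0]; [d >= r] gives [t <= 1 / 2],
   which keeps enough of the quadratic term. *)
pose t := r / (2 * d).
have td : t * d = r / 2 by rewrite /t; field; rewrite gt_eqF.
have t0 : 0 < t by rewrite divr_gt0 // mulr_gt0.
have t12 : t <= 1 / 2.
  by rewrite /t ler_pdivrMr ?mulr_gt0 //; lra.
have t01 : 0 < t < 1 by rewrite t0 /=; lra.
have r2r : r / 2 < r by lra.
have := Ecvx _ _ _ _ _ t01 E0 Ey.
rewrite distrC -/d => /near_y0.
have -> : (1 - t) *: y0 + t *: y - y0 = t *: (y - y0).
  by rewrite scalerBl scale1r scalerBr addrC addrA addrA [- y0 + y0]addNr add0r addrC.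
rewrite normrZ gtr0_norm // -/d td => /(_ r2r) h.
have Kt : t * (K * d) = a0 - l.
  by rewrite mulrCA td /K; field; rewrite gt_eqF.
have sq : K * d <= mu / 4 * d ^+ 2 + K ^+ 2 / mu.
  rewrite -subr_ge0.
  have -> : mu / 4 * d ^+ 2 + K ^+ 2 / mu - K * d = (mu / 2 * d - K) ^+ 2 / mu.
    by field; rewrite gt_eqF.
  by rewrite divr_ge0 ?sqr_ge0 // ltW.
rewrite -(ler_pM2l t0).
have tsq : t * (K * d) <= t * (mu / 4 * d ^+ 2 + K ^+ 2 / mu) by rewrite ler_pM2l.
have ta : 0 <= t * (a0 - l) by rewrite mulr_ge0 ?subr_ge0 // ltW.
have tt : 0 <= mu / 2 * t * d ^+ 2 * (1 / 2 - t).
  by apply: mulr_ge0; [apply: mulr_ge0; [apply: mulr_ge0; lra | exact: sqr_ge0] | lra].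
lra.
Qed.

End StronglyConvex.

(** * Subgradients and proximity operators of alpha-convex functions *)

Section Prox.
Context {R : realType} {X : completeNormedModType R} {ip : X -> X -> R}.
Hypothesis ipP : inner_product ip.
Implicit Types (f : X -> \bar R) (alpha gamma : R) (x y z p u v : X).

Lemma proper_fin f y a : proper_fun f -> (f y <= a%:E)%E ->
  exists2 r : R, f y = r%:E & r <= a.
Proof.
move=> [fNy _]; case fy : (f y) => [r| |] //= ra.
- by exists r => //; rewrite -lee_fin.
- by have := fNy y; rewrite fy.
Qed.

Lemma convex_epi f alpha : proper_fun f -> alpha_convex alpha f ->
  strongly_convex_epi alpha (fun y a => (f y <= a%:E)%E).
Proof.
move=> pf cf y a z b k k01 fya fzb.
have [r fy ra] := proper_fin pf fya.
have [s fz sb] := proper_fin pf fzb.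
have := cf y z; rewrite fy fz !ltry => /(_ isT isT k k01).
have k0 : 0 <= k by lra.
have k1 : 0 <= 1 - k by lra.
have := ler_wpM2l k0 sb; have := ler_wpM2l k1 ra.
case fw : (f _) => [t| |] /=.
- by rewrite -!EFinM -!EFinD !lee_fin; lra.
- by rewrite -!EFinM -!EFinD.
- by move=> _ _ _; exact: leNye.
Qed.

(** Puts lower semicontinuity into the shape of the closedness hypothesis of
    [strongly_convex_min]. *)
Lemma lsc_epi f : lower_semicontinuous f -> forall c (m : R),
  (forall e : R, 0 < e -> exists y (a : R), [/\ `|y - c| < e, a < m + e & (f y <= a%:E)%E]) ->
  forall e : R, 0 < e -> (f c <= (m + e)%:E)%E.
Proof.
move=> lf c m cl e e0; rewrite leNgt; apply/negP => /lf [W + Wf].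
move=> /nbhs_ballP [r /= r0 rW].
have re0 : 0 < Num.min r e by rewrite lt_min r0.
have [y [a [yc am fya]]] := cl _ re0.
have /Wf : W y.
  apply: rW; rewrite -ball_normE /= distrC; apply: (lt_le_trans yc).
  by rewrite ge_min lexx.
apply/negP; rewrite -leNgt; apply: (le_trans fya); rewrite lee_fin.
by apply/ltW/(lt_le_trans am); rewrite lerD2l ge_min lexx orbT.
Qed.

(** A global subgradient inequality that keeps the quadratic term of alpha-convexity. Frechet
    subgradients and proximal points are both characterized by it, so later arguments use only this
    form. *)
Definition strong_subgrad alpha f p u : Prop :=
  exists2 a : R, f p = a%:E & forall z (b : R), (f z <= b%:E)%E ->
    a + ip u (z - p) + alpha / 2 * `|z - p| ^+ 2 <= b.

Lemma strong_subgrad_monotone alpha f p u q v :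
  strong_subgrad alpha f p u -> strong_subgrad alpha f q v ->
  alpha * `|p - q| ^+ 2 <= ip (u - v) (p - q).
Proof.
move=> [a fp hp] [b fq hq].
have := hp q b; have := hq p a; rewrite fp fq !lexx => /(_ isT) + /(_ isT).
by rewrite (distrC q p) !(ipE ipP); lra.
Qed.

(** Local to global: apply the Frechet inequality at [x + k (z - x)], bound the value there by
    alpha-convexity, divide by [k] and let [k], then [e], tend to 0. Conversely, near [x] the
    quadratic term is at most [e |z - x|]. *)
Lemma frechet_subgradP alpha f x u : proper_fun f -> alpha_convex alpha f ->
  frechet_subdiff ip f x u <-> strong_subgrad alpha f x u.
Proof.
move=> pf cf; split=> [[ffin hf]|[a fx hx]]; last first.
  split; first by rewrite fx.
  move=> e e0; rewrite fx /=.
  have al0 : 0 < `|alpha| + 1 by rewrite ltr_wpDl.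
  near=> z.
  case fz : (f z) => [b| |]; last by have := pf.1 z; rewrite fz.
    have : (f z <= b%:E)%E by rewrite fz.
    move=> /hx; rewrite lee_fin; apply: le_trans; rewrite lerD2l.
    have dz : `|z - x| * (`|alpha| + 1) <= e.
      rewrite -ler_pdivlMr // distrC; near: z.
      by apply: (@cvgr_dist_le _ _ _ _ _ id) => //; rewrite divr_gt0.
    have nz := normr_ge0 (z - x).
    have na : - alpha <= `|alpha| by rewrite -normrN ler_norm.
    have nn : 0 <= `|z - x| * (e - `|z - x| * (`|alpha| + 1)).
      by rewrite mulr_ge0 // subr_ge0.
    have nb : 0 <= `|z - x| ^+ 2 * (`|alpha| + alpha).
      by rewrite mulr_ge0 ?sqr_ge0 //; lra.
    have nd : 0 <= `|z - x| ^+ 2 * `|alpha| by rewrite mulr_ge0 ?sqr_ge0.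
    have ne := sqr_ge0 (`|z - x|).
    by nra.
  by rewrite leey.
have {ffin} [a fx] : exists a, f x = a%:E by exists (fine (f x)); rewrite fineK.
exists a => // z b fzb; set d := z - x.
apply: (@ler_addgt0_lin _ _ _ `|d| 1) => // e /andP[e0 _].
have /nbhs_ballP [r /= r0 hr] := hf e e0.
have nd0 : 0 < `|d| + 1 by rewrite ltr_wpDl.
(* Below [k0] the point [x + k d] stays in the ball where the Frechet inequality holds; the [+ 1]
   covers [d = 0]. *)
pose k0 := Num.min 1 (r / (`|d| + 1)).
have k00 : 0 < k0 by rewrite lt_min ltr01 divr_gt0.
apply: (@ler_addgt0_lin _ _ _ (alpha / 2 * `|d| ^+ 2) k0) => // k /andP[kp].
rewrite lt_min => /andP[k1 kr].
have k01 : 0 < k < 1 by rewrite kp.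
have fxa : (f x <= a%:E)%E by rewrite fx.
have := convex_epi pf cf k01 fxa fzb.
have zx : (1 - k) *: x + k *: z - x = k *: d.
  by rewrite /d scalerBl scale1r scalerBr -addrA addrAC addrCA subrr addr0 addrC.
have /hr : ball x r ((1 - k) *: x + k *: z).
  rewrite -ball_normE /= distrC zx normrZ gtr0_norm //.
  move: kr; rewrite ltr_pdivlMr // mulrDr mulr1; lra.
rewrite zx fx /= => h1 h2; have := le_trans h1 h2.
rewrite lee_fin !(ipE ipP) normrZ gtr0_norm // (distrC x z) -/d => h.
by rewrite -(ler_pM2l kp); lra.
Unshelve. all: by end_near.
Qed.

Section ProxMin.
Variables (f : X -> \bar R) (alpha gamma : R).
Hypotheses (pf : proper_fun f) (lf : lower_semicontinuous f).
Hypotheses (cf : alpha_convex alpha f) (gamma0 : 0 < gamma).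
Hypothesis (ag0 : 0 < 1 + gamma * alpha).

Definition prox_epi x y (a : R) : Prop :=
  exists2 b : R, (f y <= b%:E)%E & b + `|y - x| ^+ 2 / (2 * gamma) <= a.

(** The square contributes exactly [gamma^-1] to the modulus, by the convexity identity
    [sqr_norm_conv]; the sum is positive because [1 + gamma * alpha > 0]. *)
Lemma prox_epi_convex x : strongly_convex_epi (alpha + gamma^-1) (prox_epi x).
Proof.
move=> y a z b k k01 [a' fa aa'] [b' fb bb'].
eexists; first exact: (convex_epi pf cf k01 fa fb).
have -> : (1 - k) *: y + k *: z - x = (1 - k) *: (y - x) + k *: (z - x).
  by rewrite scalerBr scalerBr addrACA -opprD -scalerDl subrK scale1r.
rewrite (sqr_norm_conv ipP) opprB addrA subrK.
have k0 : 0 <= k by lra.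
have k1 : 0 <= 1 - k by lra.
have := ler_wpM2l k0 bb'; have := ler_wpM2l k1 aa'.
rewrite invfM; lra.
Qed.

Lemma prox_epi_closed x c (m : R) :
  (forall e : R, 0 < e -> exists y a, [/\ `|y - c| < e, a < m + e & prox_epi x y a]) ->
  forall e : R, 0 < e -> prox_epi x c (m + e).
Proof.
move=> cl e e0; exists (m - `|c - x| ^+ 2 / (2 * gamma) + e); last by lra.
apply: lsc_epi => // {}e {}e0.
have cx := normr_ge0 (c - x).
(* Moving from [y] to [c] costs at most [(e / D) |c - x| / gamma] in the square term; added to the
   slack [e / D] this is exactly [e]. *)
pose D := 1 + `|c - x| / gamma.
have D1 : 1 <= D by rewrite lerDl divr_ge0 // ltW.
have D0 : 0 < D by lra.
have eD0 : 0 < e / D by rewrite divr_gt0.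
have eDe : e / D <= e by rewrite ler_pdivrMr // ler_peMr // ltW.
have [y [a [yc am [b fyb ba]]]] := cl _ eD0.
exists y, b; split => //; first exact: lt_le_trans yc eDe.
have tri : `|c - x| <= `|y - x| + e / D.
  have := ler_normD (c - y) (y - x); rewrite addrA subrK (distrC c y) => h.
  by move: yc; lra.
have ny := normr_ge0 (y - x).
have sq : `|c - x| ^+ 2 - 2 * (e / D) * `|c - x| <= `|y - x| ^+ 2.
  have [le|lt] := leP (e / D) `|c - x|.
    have : (`|c - x| - e / D) ^+ 2 <= `|y - x| ^+ 2.
      by rewrite ler_pXn2r ?nnegrE ?subr_ge0 // lerBlDr.
    have := sqr_ge0 (e / D); lra.
  have := sqr_ge0 (`|y - x|); nra.
have g20 : 0 < (2 * gamma)^-1 by rewrite invr_gt0 mulr_gt0.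
have := ler_wpM2l (ltW g20) sq.
have DE : e / D + (2 * gamma)^-1 * (2 * (e / D) * `|c - x|) = e.
  by rewrite /D; field; rewrite !gt_eqF //; move: D0; rewrite /D;
     rewrite -(ltr_pM2l gamma0) mulr0 mulrDr mulr1 mulrCA divff ?gt_eqF // mulr1.
lra.
Qed.

(** The objective has a minimizer [c] with growth modulus [alpha + gamma^-1]. Expanding the square
    around [c] removes the [gamma^-1] part and leaves the subgradient inequality. *)
Lemma prox_subgrad_exists x :
  exists p, strong_subgrad alpha f p (gamma^-1 *: (x - p)).
Proof.
have mu0 : 0 < alpha + gamma^-1.
  by rewrite -(ltr_pM2l gamma0) mulr0 mulrDr divff ?gt_eqF // addrC.
have [y0 fy0] := pf.2.
have [a0 fa0] : exists a0, f y0 = a0%:E.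
  by exists (fine (f y0)); rewrite fineK // fin_numE pf.1 lt_eqF.
have [lb Elb] : exists lb : R, forall y (a : R), prox_epi x y a -> lb <= a.
  (* Lower semicontinuity bounds [f] below near [y0]; strong convexity of the objective then spreads
     a bound to the whole space. *)
  have [|W] := @lf y0 (a0 - 1); first by rewrite fa0 lte_fin; lra.
  move=> /nbhs_ballP [r /= r0 rW] Wf.
  have E0 : prox_epi x y0 (a0 + `|y0 - x| ^+ 2 / (2 * gamma)) by exists a0; rewrite ?fa0.
  apply: (strongly_convex_bounded_below (l := a0 - 1) mu0 r0 (@prox_epi_convex x) E0).
  move=> y a yr [b fb ba].
  have /Wf : W y by apply: rW; rewrite -ball_normE /= distrC.
  move=> /lt_le_trans /(_ fb); rewrite lte_fin => h.
  have : 0 <= `|y - x| ^+ 2 / (2 * gamma) by rewrite divr_ge0 ?sqr_ge0 ?mulr_ge0 // ltW.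
  lra.
have Ene : exists y (a : R), prox_epi x y a.
  by exists y0, (a0 + `|y0 - x| ^+ 2 / (2 * gamma)), a0; rewrite ?fa0.
have [c [m [cm mE]]] := strongly_convex_min mu0 (@prox_epi_convex x) Ene Elb
  (@prox_epi_closed x).
exists c.
have [b0 fcb _] := cm _ ltr01.
have [a fc _] := proper_fin pf fcb.
have acm : a + `|c - x| ^+ 2 / (2 * gamma) <= m.
  apply/ler_addgt0Pr => e /cm [b]; rewrite fc lee_fin => ab.
  by apply: le_trans; rewrite lerD2r.
exists a => // z b fzb.
have /mE : prox_epi x z (b + `|z - x| ^+ 2 / (2 * gamma)) by exists b.
have -> : z - x = (z - c) + (c - x) by rewrite addrA subrK.
have -> : x - c = - (c - x) by rewrite opprB.
move: acm; rewrite !(sqr_normE ipP) !(ipE ipP).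
rewrite (ipC ipP c z) (ipC ipP x z) (ipC ipP x c) invfM; lra.
Qed.

(** A strong subgradient gives minimality with quadratic growth. For the other direction, growth
    around the minimizer [q] already constructed forces every other minimizer to equal [q]. *)
Lemma prox_subgradP x p :
  prox gamma f x p <-> strong_subgrad alpha f p (gamma^-1 *: (x - p)).
Proof.
have mu0 : 0 < alpha + gamma^-1.
  by rewrite -(ltr_pM2l gamma0) mulr0 mulrDr divff ?gt_eqF // addrC.
have strong q a z b : (forall z (b : R), (f z <= b%:E)%E ->
    a + ip (gamma^-1 *: (x - q)) (z - q) + alpha / 2 * `|z - q| ^+ 2 <= b) ->
    (f z <= b%:E)%E -> a + `|q - x| ^+ 2 / (2 * gamma) +
      (alpha + gamma^-1) / 2 * `|z - q| ^+ 2 <= b + `|z - x| ^+ 2 / (2 * gamma).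
  move=> + fzb => /(_ z b fzb).
  have -> : z - x = (z - q) + (q - x) by rewrite addrA subrK.
  have -> : x - q = - (q - x) by rewrite opprB.
  rewrite !(sqr_normE ipP) !(ipE ipP).
  rewrite (ipC ipP q z) (ipC ipP x z) (ipC ipP x q) invfM; lra.
have pos z q : 0 <= (alpha + gamma^-1) / 2 * `|z - q| ^+ 2.
  by rewrite mulr_ge0 ?sqr_ge0 ?divr_ge0 // ltW.
split=> [px|[a fp hp] z]; last first.
  case fz : (f z) => [b| |]; last by have := pf.1 z; rewrite fz.
    have := strong p a z b hp; rewrite fp fz lexx => /(_ isT) h.
    rewrite -!EFinD lee_fin; apply: le_trans h; rewrite lerDl; exact: pos.
  by rewrite fp addye // leey.
have [q sq] := prox_subgrad_exists x; have [a fq hq] := sq.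
suff -> : p = q by [].
have := px q; rewrite fq -EFinD.
case fp : (f p) => [b| |]; [|by []|by have := pf.1 p; rewrite fp].
rewrite -EFinD lee_fin => h1.
have := strong q a p b hq; rewrite fp lexx => /(_ isT) h2.
have : (alpha + gamma^-1) / 2 * `|p - q| ^+ 2 <= 0 by lra.
rewrite pmulr_rle0 ?divr_gt0 // => h3.
apply/eqP; rewrite -subr_eq0 -normr_eq0 -sqrf_eq0 eq_le h3; exact: sqr_ge0.
Qed.

Lemma prox_exists x : exists p, prox gamma f x p.
Proof. by have [p] := prox_subgrad_exists x; exists p; apply/prox_subgradP. Qed.

Lemma prox_monotone x p y q : prox gamma f x p -> prox gamma f y q ->
  (1 + gamma * alpha) * ip (p - q) (p - q) <= ip (x - y) (p - q).
Proof.
move=> /prox_subgradP sp /prox_subgradP sq.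
have := strong_subgrad_monotone sp sq; rewrite -scalerBr (ipZl ipP).
rewrite mulrC ler_pdivlMl // => h.
have : gamma * (alpha * ip (p - q) (p - q)) <= ip (x - p - (y - q)) (p - q).
  by move: h; rewrite (sqr_normE ipP); lra.
have -> z : ip (x - p - (y - q)) z = ip (x - y) z - ip (p - q) z.
  by rewrite !(ipE ipP); ring.
lra.
Qed.

Lemma prox_uniq x p q : prox gamma f x p -> prox gamma f x q -> p = q.
Proof.
move=> xp xq; have := prox_monotone xp xq.
rewrite subrr (ip0l ipP) pmulr_rle0 // => h.
apply/eqP; rewrite -subr_eq0 -normr_eq0 -sqrf_eq0 (sqr_normE ipP) eq_le h.
exact: (ip_ge0 ipP).
Qed.

End ProxMin.
End Prox.

(** * Descent lemma and cocoercivity of the gradient *)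

Section Smooth.
Context {R : realType} {X : completeNormedModType R} {ip : X -> X -> R}.
Hypothesis ipP : inner_product ip.
Variables (h : X -> R) (G : X -> X) (sigma : R).
Hypotheses (hG : is_gradient ip h G) (hcvx : convex_fun h).
Hypotheses (sigma0 : 0 < sigma) (GL : lipschitz_with sigma^-1 G).

(** By convexity, difference quotients along the segment are at most [h y - h x]; they tend to the
    directional derivative. *)
Lemma gradient_ineq x y : h x + ip (G x) (y - x) <= h y.
Proof.
have [dh dE] := hG x.
have cv : (fun t : R => t^-1 *: ((h \o shift x) (t *: (y - x)) - h x)) @ 0^'
    --> 'D_(y - x) h x by exact: diff_derivable.
apply/ler_addgt0Pr => e e0; move/cvgrPdist_lt: cv => /(_ _ e0).
rewrite deriveE // dE => /nbhs_ballP [r /= r0 hr].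
pose t := Num.min 1 r / 2.
have m0 : 0 < Num.min 1 r by rewrite lt_min ltr01.
have m1 : Num.min 1 r <= 1 by rewrite ge_min lexx.
have mr : Num.min 1 r <= r by rewrite ge_min lexx orbT.
have t0 : 0 < t by rewrite divr_gt0.
have t01 : 0 < t < 1 by rewrite t0 /t; lra.
have : ball (0 : R) r t by rewrite -ball_normE /= sub0r normrN gtr0_norm // /t; lra.
have tn0 : t != 0 by rewrite gt_eqF.
move=> /hr /(_ tn0).
have -> : t *: (y - x) + x = (1 - t) *: x + t *: y.
  by rewrite scalerBl scale1r scalerBr addrC -addrA [- _ + _]addrC.
move=> /ltr_distlBl; rewrite /GRing.scale /=.
have := hcvx x y t01; set w := h _ => cw.
have : t^-1 * (w - h x) <= h y - h x by rewrite ler_pdivrMl //; lra.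
lra.
Qed.

(* Telescoping the gradient inequality along n equal steps. *)
Lemma descent_steps x d n :
  h (x + n%:R *: d) <=
  h x + n%:R * ip (G x) d + n%:R * (n%:R + 1) / 2 * (sigma^-1 * `|d| ^+ 2).
Proof.
elim: n => [|n IHn]; first by rewrite scale0r addr0; lra.
set y := x + n.+1%:R *: d.
have yE : x + n%:R *: d - y = - d.
  by rewrite /y -addn1 natrD scalerDl scale1r opprD addrACA subrr add0r opprD addrA subrr add0r.
have := gradient_ineq y (x + n%:R *: d); rewrite yE (ipNr ipP) => g1.
have g2 : ip (G y) d <= ip (G x) d + sigma^-1 * (n%:R + 1) * `|d| ^+ 2.
  have -> : ip (G y) d = ip (G x) d + ip (G y - G x) d by rewrite !(ipE ipP); ring.
  rewrite lerD2l; apply: (le_trans (ip_le_norm ipP _ _)).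
  rewrite expr2 mulrA ler_wpM2r //; apply: (le_trans (GL _ _)).
  by rewrite /y addrAC subrr add0r normrZ normr_nat -natr1 mulrA.
rewrite -natr1; lra.
Qed.

(** Cutting [d] into [n] equal steps gives this bound with the square term multiplied by
    [1 + 1 / n]; let [n] grow. This replaces integrating the gradient along the segment. *)
Lemma descent_lemma x d : h (x + d) <= h x + ip (G x) d + (2 * sigma)^-1 * `|d| ^+ 2.
Proof.
have bnd (n : nat) : h (x + d) <= h x + ip (G x) d + (2 * sigma)^-1 * `|d| ^+ 2 +
    n.+1%:R^-1 * ((2 * sigma)^-1 * `|d| ^+ 2).
  have n0 : (n.+1%:R : R) != 0 by rewrite pnatr_eq0.
  have := descent_steps x (n.+1%:R^-1 *: d) n.+1.
  rewrite scalerA divff // scale1r (ipZr ipP) mulVKf //.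
  rewrite normrZ exprMn normfV normr_nat => /le_trans; apply.
  rewrite -!addrA !lerD2l le_eqVlt; apply/orP; left; apply/eqP.
  by field; rewrite nat1r n0 gt_eqF.
apply: (@ler_addgt0_lin _ _ _ ((2 * sigma)^-1 * `|d| ^+ 2) 1) => // k /andP[k0 _].
have [n nk] : exists n : nat, n.+1%:R^-1 < k.
  have /cvgrPdist_lt /(_ _ k0) [N _ hN] := @cvg_harmonic R.
  exists N; have := hN N (leqnn N); rewrite /= sub0r normrN.
  exact: le_lt_trans (ler_norm _).
apply: (le_trans (bnd n)); rewrite lerD2l ler_wpM2r //; last exact: ltW.
by rewrite mulr_ge0 ?sqr_ge0 // invr_ge0 mulr_ge0 // ltW.
Qed.

(** Compare at the gradient step [x - sigma c], with [c = G x - G y]: the gradient inequality from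
    [y] bounds [h] below there, the descent lemma from [x] bounds it above. *)
Lemma bregman_lower x y :
  ip (G y) (x - y) + sigma / 2 * ip (G x - G y) (G x - G y) <= h x - h y.
Proof.
(* Keeps [c] opaque, so that bilinear expansion does not split it. *)
have [c cE] : exists c, c = G x - G y by exists (G x - G y).
rewrite -cE.
have := gradient_ineq y (x - sigma *: c); have := descent_lemma x (- (sigma *: c)).
rewrite (sqr_normE ipP) !(ipE ipP).
have -> : ip (G x) c = ip c c + ip (G y) c by rewrite -(ipDl ipP) cE subrK.
have : (2 * sigma)^-1 * (sigma * (sigma * ip c c)) = sigma / 2 * ip c c.
  by field; rewrite gt_eqF.
lra.
Qed.

(* Baillon-Haddad. *)
Lemma gradient_cocoercive x y :
  sigma * ip (G x - G y) (G x - G y) <= ip (G x - G y) (x - y).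
Proof.
have := bregman_lower x y; have := bregman_lower y x.
rewrite -[G y - G x]opprB -[y - x]opprB; set c := G x - G y.
have -> : ip c (x - y) = ip (G x) (x - y) - ip (G y) (x - y) by rewrite (ipDl ipP) (ipNl ipP).
by rewrite !(ipNl ipP) !(ipNr ipP); lra.
Qed.

End Smooth.

(** * Monotone real sequences *)

Section RealSequences.
Context {R : realType}.

Lemma nonincreasing_limit (d : nat -> R) :
  (forall n, 0 <= d n) -> (forall n, d n.+1 <= d n) ->
  exists2 L : R, (forall n, L <= d n) &
    forall e : R, 0 < e -> \forall n \near \oo, d n < L + e.
Proof.
move=> d0 dS; have dn : nonincreasing_seq d by apply/nonincreasing_seqP.
have dc : cvgn d by apply: nonincreasing_is_cvgn => //; exists 0 => _ [n _ <-].
exists (limn d) => [n|e e0]; first exact: nonincreasing_cvgn_ge.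
have /cvgrPdist_lt /(_ _ e0) : d @ \oo --> limn d by [].
by apply: filterS => n /=; rewrite distrC => /ltr_distlDr.
Qed.

(** Since [r] is nonincreasing, [(n - m) kap r n] is at most the drop of [d] from [m] to [n]. That
    drop is small once [d m] is near its limit, and [n <= 2 (n - m)] as soon as [n >= 2 m]. *)
Lemma monotone_summable (d r : nat -> R) (kap : R) :
  0 < kap -> (forall n, 0 <= d n) -> (forall n, 0 <= r n) ->
  (forall n, r n.+1 <= r n) -> (forall n, kap * r n <= d n - d n.+1) ->
  (fun n => n%:R * r n) @ \oo --> 0.
Proof.
move=> kap0 d0 r0 rS drop.
have dS n : d n.+1 <= d n.
  have := drop n; have : 0 <= kap * r n by rewrite mulr_ge0 // ltW.
  lra.
have [L Ld Llim] := nonincreasing_limit d0 dS.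
have tail m k : k%:R * (kap * r (m + k)%N) <= d m - d (m + k)%N.
  elim: k => [|k IHk]; first by rewrite mul0r addn0 subrr.
  have h1 := drop (m + k)%N.
  have h2 : kap * r (m + k).+1 <= kap * r (m + k)%N by rewrite ler_pM2l.
  have h3 : k%:R * (kap * r (m + k).+1) <= k%:R * (kap * r (m + k)%N).
    by rewrite ler_wpM2l.
  by rewrite addnS -natr1; lra.
apply/cvgrPdist_lt => e e0.
have ke0 : 0 < kap * e / 2 by rewrite divr_gt0 // mulr_gt0.
have [m dm] := filter_ex (Llim _ ke0).
exists (m + m)%N => // n /= mmn.
rewrite sub0r normrN ger0_norm ?mulr_ge0 //.
have mn : (m <= n)%N by apply: leq_trans mmn; rewrite leq_addr.
have := tail m (n - m)%N; rewrite subnKC // => h.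
have h2 : n%:R <= 2 * (n - m)%:R :> R.
  rewrite -natrM ler_nat mul2n -addnn.
  by rewrite -{1}(subnK mn) leq_add2l leq_subRL.
have h3 : n%:R * (kap * r n) <= 2 * (n - m)%:R * (kap * r n).
  by rewrite ler_wpM2r // mulr_ge0 // ltW.
rewrite -(ltr_pM2l kap0).
have := Ld n; lra.
Qed.

End RealSequences.

(** * Asymptotic centers and Krasnoselskii-Mann iteration *)

Section KrasnoselskiiMann.
Context {R : realType} {X : completeNormedModType R} {ip : X -> X -> R}.
Hypothesis ipP : inner_product ip.
Implicit Types (x y z c : X) (u : nat -> X) (a e m : R).

(* [c] minimizes limsup_F |u n - y|^2 over [y], with minimal value [m]. *)
Definition asymptotic_center (F : set_system nat) u c m : Prop :=
  (forall e, 0 < e -> \forall n \near F, `|u n - c| ^+ 2 <= m + e) /\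
  forall y a, (\forall n \near F, `|u n - y| ^+ 2 <= a) -> m + `|y - c| ^+ 2 <= a.

(** The function [limsup |u n - y|^2] inherits 2-strong convexity from the square, so
    [strongly_convex_min] applies. A general filter [F] allows limsups along subfamilies. *)
Lemma asymptotic_center_exists (F : set_system nat) u y0 a0 : ProperFilter F ->
  (\forall n \near F, `|u n - y0| ^+ 2 <= a0) -> exists c m, asymptotic_center F u c m.
Proof.
move=> FF bnd.
pose E y a := \forall n \near F, `|u n - y| ^+ 2 <= a.
have Ecvx : strongly_convex_epi 2 E.
  move=> y a z b k /andP[k0 k1] Ey Ez.
  rewrite /E; apply: filterS (filterI Ey Ez) => n [/= hy hz].
  have -> : u n - ((1 - k) *: y + k *: z) = (1 - k) *: (u n - y) + k *: (u n - z).
    by rewrite !scalerBr addrACA -opprD -scalerDl subrK scale1r.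
  rewrite (sqr_norm_conv ipP).
  have -> : `|u n - y - (u n - z)| = `|y - z|.
    by rewrite opprB addrC addrA subrK distrC.
  have : (1 - k) * `|u n - y| ^+ 2 <= (1 - k) * a by rewrite ler_wpM2l //; lra.
  have : k * `|u n - z| ^+ 2 <= k * b by rewrite ler_wpM2l //; lra.
  lra.
have Elb y a : E y a -> 0 <= a.
  by move=> Ey; have [n /= h] := filter_ex Ey; apply: le_trans h; rewrite sqr_ge0.
have Ecl c m : (forall e, 0 < e -> exists y a, [/\ `|y - c| < e, a < m + e & E y a]) ->
    forall e, 0 < e -> E c (m + e).
  move=> cl e e0.
  have D0 : 0 < `|m| + 4 by rewrite ltr_wpDl.
  (* From [2 |u n - y| <= 1 + |u n - y|^2], moving the center by [e'] costs at most [e' (|m| + 4)]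
     in all when [e' <= 1]. *)
  pose e' := Num.min 1 (e / (`|m| + 4)).
  have e'0 : 0 < e' by rewrite lt_min ltr01 divr_gt0.
  have e'1 : e' <= 1 by rewrite ge_min lexx.
  have e'D : e' * (`|m| + 4) <= e by rewrite -ler_pdivlMr // ge_min lexx orbT.
  have [y [a [yc am Ey]]] := cl _ e'0.
  rewrite /E; apply: filterS Ey => n /= h.
  have tri : `|u n - c| <= `|u n - y| + e'.
    have := ler_normD (u n - y) (y - c); rewrite addrA subrK; lra.
  have nc := normr_ge0 (u n - c); have ny := normr_ge0 (u n - y).
  have sq : `|u n - c| ^+ 2 <= (`|u n - y| + e') ^+ 2.
    by rewrite ler_pXn2r ?nnegrE // addr_ge0 // ltW.
  have yg : 0 <= e' * (1 - `|u n - y|) ^+ 2 by rewrite mulr_ge0 ?sqr_ge0 // ltW.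
  have lm : e' * m <= e' * `|m| by rewrite ler_pM2l // ler_norm.
  have hh : e' * `|u n - y| ^+ 2 <= e' * (m + e') by rewrite ler_pM2l //; lra.
  have ee : e' * e' <= e' by rewrite ler_piMr // ltW.
  nra.
have Ene : exists y a, E y a by exists y0, a0.
have [c [m [h1 h2]]] := strongly_convex_min (ltr0Sn R 1) Ecvx Ene Elb Ecl.
exists c, m; split => // y a /h2; rewrite divff ?mul1r //.
Qed.

Lemma weak_cvg_half u c :
  (forall y e, 0 < e -> \forall n \near \oo, ip (u n - c) y < e) -> weak_cvg ip u c.
Proof.
move=> half y; apply/cvgrPdist_lt => e e0.
apply: filterS (filterI (half y e e0) (half (- y) e e0)) => n [/=].
by rewrite !(ipE ipP) ltr_norml; lra.
Qed.

Section Iteration.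
Variables (N : X -> X) (theta : R) (x : nat -> X).
Hypotheses (Nne : nonexpansive N) (theta0 : 0 < theta) (theta1 : theta < 1).
Hypothesis xS : forall n, x n.+1 = (1 - theta) *: x n + theta *: N (x n).

Let Nle y z : `|N y - N z| <= `|y - z|.
Proof. by have := Nne y z; rewrite mul1r. Qed.

Lemma fejer z n : N z = z ->
  `|x n.+1 - z| ^+ 2 <=
  `|x n - z| ^+ 2 - theta * (1 - theta) * `|x n - N (x n)| ^+ 2.
Proof.
move=> Nz; rewrite xS.
have -> : (1 - theta) *: x n + theta *: N (x n) - z =
          (1 - theta) *: (x n - z) + theta *: (N (x n) - z).
  by rewrite !scalerBr addrACA -opprD -scalerDl subrK scale1r.
rewrite (sqr_norm_conv ipP) opprB addrA subrK.
have h : `|N (x n) - z| ^+ 2 <= `|x n - z| ^+ 2.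
  by rewrite ler_pXn2r ?nnegrE // -{1}Nz.
have : theta * `|N (x n) - z| ^+ 2 <= theta * `|x n - z| ^+ 2 by rewrite ler_pM2l.
lra.
Qed.

(** Pass through [N (x n)]: the two legs are at most [1 - theta] and [theta] times the old
    residual. *)
Lemma residualS n : `|x n.+1 - N (x n.+1)| <= `|x n - N (x n)|.
Proof.
have e1 : x n.+1 - N (x n) = (1 - theta) *: (x n - N (x n)).
  by rewrite xS scalerBr -addrA; congr (_ + _); rewrite scalerBl scale1r opprB.
have e2 : x n - x n.+1 = theta *: (x n - N (x n)).
  rewrite xS scalerBl scale1r scalerBr opprD opprB addrA.
  by rewrite [x n + _]addrC subrK.
have := ler_normD (x n.+1 - N (x n)) (N (x n) - N (x n.+1)).
rewrite addrA subrK e1 normrZ (@ger0_norm _ (1 - theta)) ?subr_ge0; last exact: ltW.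
have := Nle (x n) (x n.+1); rewrite e2 normrZ gtr0_norm //.
lra.
Qed.

(** The Fejer inequality makes the squared residuals summable and [residualS] makes them monotone,
    which gives the rate. *)
Lemma residual_o z : N z = z ->
  (fun n => n%:R * `|x n - N (x n)| ^+ 2) @ \oo --> 0.
Proof.
move=> Nz; apply: (@monotone_summable _ (fun n => `|x n - z| ^+ 2) _ (theta * (1 - theta))).
- by rewrite mulr_gt0 // subr_gt0.
- by move=> n; rewrite sqr_ge0.
- by move=> n; rewrite sqr_ge0.
- by move=> n; rewrite ler_pXn2r ?nnegrE // residualS.
- by move=> n; have := fejer n Nz; lra.
Qed.

Lemma residual_cvg0 z : N z = z -> (fun n => x n - N (x n)) @ \oo --> 0.
Proof.
move=> /residual_o/cvgrPdist_lt h; apply/cvgrPdist_lt => e e0.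
have := h _ (exprn_gt0 2 e0) => -[M _ hM]; exists M.+1 => // n /= Mn.
have n1 : 1 <= n%:R :> R by rewrite ler1n; apply: leq_trans Mn.
have := hM n (ltnW Mn); rewrite /= !sub0r !normrN ger0_norm ?mulr_ge0 // => hn.
rewrite -(@ltr_pXn2r _ 2%N) ?nnegrE //; last exact: ltW.
apply: le_lt_trans hn; rewrite ler_peMl //.
Qed.

Lemma iterates_o z : N z = z ->
  (fun n => Num.sqrt (n%:R) * `|x n - x n.+1|) @ \oo --> 0.
Proof.
move=> /residual_o; apply: cvg_sqr_dist => n.
rewrite subr0 ger0_norm ?mulr_ge0 ?sqrtr_ge0 // exprMn sqr_sqrtr // ler_wpM2l //.
have -> : x n - x n.+1 = theta *: (x n - N (x n)).
  rewrite xS scalerBl scale1r scalerBr opprD opprB addrA.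
  by rewrite [x n + _]addrC subrK.
rewrite normrZ gtr0_norm // exprMn ler_piMl ?sqr_ge0 //.
by rewrite expr_le1 // ltW.
Qed.

(* limsup |x n - N c| <= limsup |N (x n) - N c| <= limsup |x n - c|. *)
Lemma center_fixed (F : set_system nat) z c m : ProperFilter F -> \oo `<=` F ->
  N z = z -> asymptotic_center F x c m -> N c = c.
Proof.
move=> FF Foo Nz [cm cmin].
suff : `|N c - c| ^+ 2 <= 0.
  move=> h; apply/eqP; rewrite -subr_eq0 -normr_eq0 -sqrf_eq0 eq_le h; exact: sqr_ge0.
apply: (@ler_addgt0_lin _ _ _ 2 1) => // e /andP[e0 _]; rewrite add0r.
suff /cmin : \forall n \near F, `|x n - N c| ^+ 2 <= m + e * 2 by lra.
have D0 : 0 < 2 + `|m| + e by rewrite ltr_wpDl // ltW.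
(* With [s] the residual, [2 s |x n - c| <= s (1 + |x n - c|^2)], so the total cost is at most
   [s (2 + |m| + e) <= e]. *)
pose s0 := Num.min 1 (e / (2 + `|m| + e)).
have s00 : 0 < s0 by rewrite lt_min ltr01 divr_gt0.
have s01 : s0 <= 1 by rewrite ge_min lexx.
have s0D : s0 * (2 + `|m| + e) <= e by rewrite -ler_pdivlMr // ge_min lexx orbT.
have := residual_cvg0 Nz => /cvgrPdist_lt /(_ _ s00) /Foo near1.
apply: filterS (filterI near1 (cm _ e0)) => n [/=].
rewrite sub0r normrN => rs h.
set s := `|_ - _| in rs.
have tri : `|x n - N c| <= s + `|x n - c|.
  have := ler_normD (x n - N (x n)) (N (x n) - N c); rewrite addrA subrK -/s.
  by have := Nle (x n) c; lra.
have sge : 0 <= s by exact: normr_ge0.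
have t0 := normr_ge0 (x n - c).
have sq : `|x n - N c| ^+ 2 <= (s + `|x n - c|) ^+ 2.
  by rewrite ler_pXn2r ?nnegrE // addr_ge0.
have yg : 0 <= s * (1 - `|x n - c|) ^+ 2 by rewrite mulr_ge0 ?sqr_ge0.
have hh : s * `|x n - c| ^+ 2 <= s * (m + e) by rewrite ler_wpM2l.
have lm : s * m <= s * `|m| by rewrite ler_wpM2l // ler_norm.
have ss : s * s <= s by rewrite ler_piMr //; lra.
have sD : s * (2 + `|m| + e) <= s0 * (2 + `|m| + e) by rewrite ler_wpM2r // ltW.
nra.
Qed.

(* Every cofinal subfamily of the iterates has the same asymptotic center [c];
   if <x n - c, y> stayed above [e] along one of them, then [c + y] would beat [c]. *)
Lemma iterates_weak_cvg z : N z = z -> exists2 c, N c = c & weak_cvg ip x c.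
Proof.
move=> Nz.
have lims w : N w = w -> exists2 L, (forall n, L <= `|x n - w| ^+ 2) &
    forall e : R, 0 < e -> \forall n \near \oo, `|x n - w| ^+ 2 < L + e.
  move=> Nw; apply: nonincreasing_limit => n; first exact: sqr_ge0.
  have := fejer n Nw.
  have : 0 <= theta * (1 - theta) * `|x n - N (x n)| ^+ 2.
    by rewrite !mulr_ge0 ?sqr_ge0 // ?subr_ge0 ltW.
  lra.
have [Lz _ Lzlim] := lims z Nz.
have zbnd : \forall n \near \oo, `|x n - z| ^+ 2 <= Lz + 1.
  by apply: filterS (Lzlim _ ltr01) => n; exact: ltW.
have [c [m cm]] := asymptotic_center_exists _ zbnd.
have Nc : N c = c by apply: (center_fixed _ _ Nz cm).
exists c => //; apply: weak_cvg_half => y e e0.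
apply: contrapT => nfar.
(* Failure of the bound means that this set meets every tail, so restricting to it leaves a proper
   filter. *)
pose A : set nat := [set n | e <= ip (x n - c) y].
have FF : ProperFilter (within A \oo).
  split; last exact: within_filter.
  move=> /= w0; apply: nfar; apply: (@filterS _ \oo _ _ _ _ w0) => n /= nA.
  by rewrite ltNge; apply/negP.
have Foo : \oo `<=` within A \oo by move=> P; apply: filterS => n.
have [c' [m' cm']] := asymptotic_center_exists FF (Foo _ zbnd).
have Nc' : N c' = c' by exact: (center_fixed FF Foo Nz cm').
have [L Lle Llim] := lims c Nc; have [L' L'le L'lim] := lims c' Nc'.
have Lm : L <= m.
  apply/ler_addgt0Pr => t t0; have [n /= h] := filter_ex (cm.1 _ t0).
  exact: le_trans (Lle n) h.
have L'm' : L' <= m'.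
  apply/ler_addgt0Pr => t t0; have [n /= h] := filter_ex (cm'.1 _ t0).
  exact: le_trans (L'le n) h.
have h1 : m + `|c' - c| ^+ 2 <= L'.
  apply/ler_addgt0Pr => t t0; apply: cm.2.
  by apply: filterS (L'lim _ t0) => n; exact: ltW.
have h2 : m' + `|c - c'| ^+ 2 <= L.
  apply/ler_addgt0Pr => t t0; apply: cm'.2; apply: Foo.
  by apply: filterS (Llim _ t0) => n; exact: ltW.
have sq := sqr_ge0 (`|c - c'|).
(* Adding [m + |c' - c|^2 <= L' <= m'] and [m' + |c - c'|^2 <= L <= m]. *)
have cc' : c' = c.
  apply/eqP; rewrite -subr_eq0 -normr_eq0 -sqrf_eq0 eq_le sqr_ge0 andbT.
  by move: h1; rewrite distrC; move: h2 sq; rewrite (distrC c c'); lra.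
(* On [A], expanding the square at [c + y] gains [2 e] from the inner product. With [c' = c] this
   yields [m' <= L - e], against [L <= m <= m']. *)
have : m' + `|c + y - c'| ^+ 2 <= L + e - 2 * e + `|y| ^+ 2.
  apply: cm'.2; apply: filterS (Llim _ e0) => n /= xnc An.
  rewrite opprD addrA; move: An xnc; rewrite /A /= !(sqr_normE ipP).
  rewrite !(ipE ipP) (ipC ipP y (x n)) (ipC ipP c (x n)) (ipC ipP y c); lra.
have sq' := sqr_ge0 (`|c' - c|).
by rewrite cc' addrAC subrr add0r; lra.
Qed.

End Iteration.
End KrasnoselskiiMann.

(** * Products of null and bounded sequences *)

Section Bounded.
Context {R : realType} {X : completeNormedModType R} {ip : X -> X -> R}.
Hypothesis ipP : inner_product ip.
Implicit Types (u v : nat -> X) (x : X).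

Definition eventually_bounded u : Prop :=
  exists M : R, \forall n \near \oo, `|u n| <= M.

Lemma eventually_boundedD u v : eventually_bounded u -> eventually_bounded v ->
  eventually_bounded (fun n => u n + v n).
Proof.
move=> [M hM] [M' hM']; exists (M + M'); apply: filterS (filterI hM hM') => n [/= h h'].
by apply: (le_trans (ler_normD _ _)); rewrite lerD.
Qed.

Lemma eventually_boundedZ (a : R) u : eventually_bounded u ->
  eventually_bounded (fun n => a *: u n).
Proof.
move=> [M hM]; exists (`|a| * M); apply: filterS hM => n h.
by rewrite normrZ ler_wpM2l.
Qed.

Lemma eventually_bounded_cst (x : X) : eventually_bounded (fun=> x).
Proof. by exists `|x|; apply: nearW. Qed.

Lemma eventually_bounded_cvg u x : u @ \oo --> x -> eventually_bounded u.
Proof.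
move=> /cvgrPdist_lt /(_ _ ltr01) h; exists (`|x| + 1); apply: filterS h => n h.
have := ler_normD x (u n - x); rewrite addrC subrK.
by rewrite distrC in h; lra.
Qed.

Lemma ip_cvg0 u v : u @ \oo --> 0 -> eventually_bounded v ->
  (fun n => ip (u n) (v n)) @ \oo --> 0.
Proof.
move=> /cvgrPdist_lt hu [M hM]; apply/cvgrPdist_lt => e e0.
have M0 : 0 < `|M| + 1 by rewrite ltr_wpDl.
have eM : 0 < e / (`|M| + 1) by rewrite divr_gt0.
apply: filterS (filterI (hu _ eM) hM) => n [/=].
rewrite !sub0r !normrN ltr_pdivlMr // => un vn.
have lM := ler_norm M.
(* Stated for every [w] of that norm, to serve both [u n] and its opposite. *)
have h (w : X) : `|w| = `|u n| -> ip w (v n) < e.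
  move=> wu; apply: le_lt_trans un; apply: (le_trans (ip_le_norm ipP _ _)).
  by rewrite wu ler_wpM2l //; lra.
by rewrite ltr_norml h // andbT ltrNl -(ipNl ipP) h // normrN.
Qed.

Lemma weak_cvgB u v x : weak_cvg ip u x -> v @ \oo --> 0 ->
  weak_cvg ip (fun n => u n - v n) x.
Proof.
move=> ux v0 y; have := ip_cvg0 v0 (eventually_bounded_cst y) => /(cvgB (ux y)).
rewrite subr0; apply: cvg_trans; apply: near_eq_cvg; apply: nearW => n /=.
by rewrite !(ipE ipP).
Qed.

End Bounded.

(** * The quadratic form of the splitting and its best constant *)

Section Splitting.
Context {R : realType} {X : completeNormedModType R} {ip : X -> X -> R}.
Hypothesis ipP : inner_product ip.
Variables (alpha beta sigma gamma delta etastar : R).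
Hypotheses (sigma0 : 0 < sigma) (gamma0 : 0 < gamma) (delta0 : 0 < delta).
Hypothesis etastar0 : 0 < etastar.
Hypothesis cond : cond_a alpha beta sigma gamma delta etastar \/
                  cond_b alpha beta sigma gamma delta etastar.

Let gneq : gamma != 0. Proof. by rewrite gt_eqF. Qed.
Let dneq : delta != 0. Proof. by rewrite gt_eqF. Qed.
Let sneq : sigma != 0. Proof. by rewrite gt_eqF. Qed.

Lemma cond_aE : cond_a alpha beta sigma gamma delta etastar ->
  [/\ beta = - alpha, gamma / delta = 1 + 2 * gamma * alpha
    & etastar = 2 + 2 * gamma * alpha - gamma / (2 * sigma)].
Proof.
move=> [ab k0 dE eE]; split => //; first lra.
rewrite dE invfM invrK mulrA divff ?mul1r //.
Qed.

(** Under (a), [(gamma / delta) (1 + delta beta) = 1 + gamma alpha]. Under (b), [etastar > 0] makes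
    the product of the two factors positive; both negative would force [alpha] and [beta] negative,
    against [alpha + beta > 0]. *)
Lemma resolvent_coef_gt0 : 0 < 1 + gamma * alpha /\ 0 < 1 + delta * beta.
Proof.
case: cond => [ca|[ab0 eE]].
  have [bE kE _] := cond_aE ca; have [_ k0 _ _] := ca.
  have A0 : 0 < 1 + gamma * alpha by nra.
  split => //; rewrite -(ltr_pM2l gamma0) mulr0 -(ltr_pM2l (_ : 0 < delta^-1)) ?invr_gt0 //.
  rewrite mulr0; have -> : delta^-1 * (gamma * (1 + delta * beta)) = gamma / delta + gamma * beta.
    by field.
  by rewrite kE bE; lra.
have den0 : 0 < 2 * gamma * delta ^+ 2 * (alpha + beta) by rewrite !mulr_gt0.
have gs0 : 0 < gamma / (2 * sigma) by rewrite divr_gt0 ?mulr_gt0.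
have : 0 < etastar + gamma / (2 * sigma) by rewrite addr_gt0.
rewrite eE subrK pmulr_lgt0 ?invr_gt0 // subr_gt0 => h.
have : 0 < 4 * gamma * delta * (1 + gamma * alpha) * (1 + delta * beta).
  by apply: le_lt_trans h; rewrite sqr_ge0.
have c0 : 0 < 4 * gamma * delta by rewrite !mulr_gt0.
rewrite -mulrA (pmulr_rgt0 _ c0) => AB.
have [A0|A0] := ltP 0 (1 + gamma * alpha).
  by split => //; rewrite -(pmulr_rgt0 _ A0).
have B0 : 1 + delta * beta < 0.
  have [//|B0] := ltP (1 + delta * beta) 0.
  by have := mulr_le0_ge0 A0 B0; lra.
have a0 : alpha < 0.
  by rewrite -(ltr_pM2l gamma0) mulr0; lra.
have b0 : beta < 0.
  by rewrite -(ltr_pM2l delta0) mulr0; lra.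
by lra.
Qed.

(** [A], [B], [C] come from adding the two resolvent inequalities, the second scaled by
    [gamma / delta]; [D = A + B - C]. In [kap], the share of [etastar] lost to the smooth term is
    restored. *)
Let A := 1 + gamma * alpha.
Let B := gamma / delta + gamma * beta.
Let C := 1 + gamma / delta.
Let D := gamma * (alpha + beta).
Let kap := (etastar + gamma / (2 * sigma)) / 2.

(** In the variables [P] and [r], the mixed term of the form is [-2 cross_coef] times [<P, r>]. *)
Definition cross_coef : R := B - C / 2.

(** Equivalent to [D (B - kap) = cross_coef^2], a vanishing discriminant. Under (a) both sides are
    0. *)
Lemma kap_discriminant : D * kap = A * B - C ^+ 2 / 4.
Proof.
rewrite /D /kap /A /B /C; case: cond => [ca|[ab0 eE]].
  have [-> -> ->] := cond_aE ca; field; exact: sneq.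
have abn : alpha + beta != 0 by rewrite gt_eqF.
rewrite eE subrK; field; rewrite dneq abn; exact: gneq.
Qed.

(* Completing the square: kap is the largest constant for which the form
   A|P|^2 + B|Q|^2 - C<P,Q> - kap|P - Q|^2 is nonnegative, so the form degenerates
   to a multiple of a perfect square; here Q = P - r. *)
Lemma quadratic_form_square P r :
  `|D *: P - cross_coef *: r| ^+ 2 =
  D * (A * ip P P + B * ip (P - r) (P - r) - C * ip P (P - r) - kap * ip r r).
Proof.
rewrite (sqr_normE ipP) !(ipE ipP) (ipC ipP r P).
have := congr1 (fun t => t * ip r r) kap_discriminant.
have : D = A + B - C by rewrite /D /A /B /C; ring.
rewrite /cross_coef; move: kap A B C D => k a b c d -> /= hk; lra.
Qed.

(** Under (a), [A = B = C / 2 = kap] and equality holds; under (b), the perfect square is divided by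
    [D > 0]. *)
Lemma quadratic_form_ge P r :
  kap * ip r r <= A * ip P P + B * ip (P - r) (P - r) - C * ip P (P - r).
Proof.
rewrite -subr_ge0; case: cond => [ca|[ab0 eE]].
  have [bE kE eE] := cond_aE ca.
  rewrite /kap /A /B /C eE bE kE subrK !(ipE ipP) (ipC ipP r P).
  by rewrite le_eqVlt; apply/orP; left; apply/eqP; field.
have D0 : 0 < D by rewrite mulr_gt0.
by rewrite -(pmulr_rge0 _ D0) -quadratic_form_square sqr_ge0.
Qed.

(** All three follow from [key], the sum of the hypotheses with weights 1, [gamma / delta] and
    [gamma]. Young with parameter [2 sigma] spends the whole cocoercivity term (first and third
    bounds); with [sigma] it keeps half of it (second bound). *)
Lemma splitting_ineqs (x P r c : X) :
  (1 + gamma * alpha) * ip P P <= ip x P ->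
  (1 + delta * beta) * ip (P - r) (P - r) <=
    ip (- (delta / gamma) *: x + (1 + delta / gamma) *: P - delta *: c) (P - r) ->
  sigma * ip c c <= ip c P ->
  [/\ etastar / 2 * ip r r <= ip x r,
      gamma * sigma / 2 * ip c c <= ip x r + gamma / (2 * sigma) * ip r r
    & `|D *: P - cross_coef *: r| ^+ 2 <= D * (ip x r + gamma / (4 * sigma) * ip r r)].
Proof.
move=> h1 h2 h3.
have key : A * ip P P + B * ip (P - r) (P - r) - C * ip P (P - r)
    + gamma * sigma * ip c c - gamma * ip c r <= ip x r.
  have : B * ip (P - r) (P - r) <= gamma / delta *
      ip (- (delta / gamma) *: x + (1 + delta / gamma) *: P - delta *: c) (P - r).
    have -> : B = gamma / delta * (1 + delta * beta) by rewrite /B; field.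
    by rewrite -mulrA ler_pM2l // divr_gt0.
  have -> : gamma / delta *
      ip (- (delta / gamma) *: x + (1 + delta / gamma) *: P - delta *: c) (P - r) =
      - ip x (P - r) + C * ip P (P - r) - gamma * ip c (P - r).
    rewrite !(ipDl ipP) !(ipNl ipP) !(ipZl ipP) /C; field; rewrite dneq; exact: gneq.
  have := ler_wpM2l (ltW gamma0) h3.
  have -> : ip x (P - r) = ip x P - ip x r by rewrite !(ipE ipP).
  have -> : ip c (P - r) = ip c P - ip c r by rewrite !(ipE ipP).
  move: h1; rewrite -/A; lra.
have qf := quadratic_form_ge P r.
have r0 := ip_ge0 ipP r.
have kE : 2 * kap = etastar + gamma / (2 * sigma) by rewrite /kap; lra.
have gs0 : 0 < gamma / (2 * sigma) by rewrite divr_gt0 ?mulr_gt0.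
have kap0 : 0 <= kap * ip r r.
  rewrite mulr_ge0 // -(ler_pM2l (ltr0Sn R 1)) mulr0 kE; exact/ltW/addr_gt0.
have y1 : gamma * ip c r <= gamma * sigma * ip c c + gamma / (4 * sigma) * ip r r.
  have s20 : 0 < 2 * sigma by rewrite mulr_gt0.
  have := ler_wpM2l (ltW gamma0) (ip_young ipP c r s20).
  congr (_ <= _); field; exact: sneq.
have y2 : gamma * ip c r <= gamma * sigma / 2 * ip c c + gamma / (2 * sigma) * ip r r.
  have := ler_wpM2l (ltW gamma0) (ip_young ipP c r sigma0).
  congr (_ <= _); field; exact: sneq.
have gE : gamma / (4 * sigma) * ip r r = gamma / (2 * sigma) / 2 * ip r r.
  by field; exact: sneq.
split.
- have : (2 * kap) * ip r r = etastar * ip r r + gamma / (2 * sigma) * ip r r.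
    by rewrite kE mulrDl.
  lra.
- lra.
- rewrite quadratic_form_square ler_wpM2l //; last lra.
  rewrite /D mulr_ge0 //; first exact: ltW.
  by case: cond => [[-> _ _ _]//|[/ltW]].
Qed.

(** * Steps of the algorithm, zeros and weak limits *)

Section Steps.
Variables (f g : X -> \bar R) (h : X -> R) (G : X -> X).
Hypotheses (pf : proper_fun f) (lf : lower_semicontinuous f) (cf : alpha_convex alpha f).
Hypotheses (pg : proper_fun g) (lg : lower_semicontinuous g) (cg : alpha_convex beta g).
Hypotheses (hG : is_gradient ip h G) (hcvx : convex_fun h).
Hypothesis GL : lipschitz_with sigma^-1 G.

Definition dr_step (x p q : X) : Prop :=
  prox gamma f x p /\ prox delta g (S_op gamma delta G p x) q.

Let A0 : 0 < 1 + gamma * alpha := (resolvent_coef_gt0).1.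
Let B0 : 0 < 1 + delta * beta := (resolvent_coef_gt0).2.

Lemma S_opB x p x' p' : S_op gamma delta G p x - S_op gamma delta G p' x' =
  - (delta / gamma) *: (x - x') + (1 + delta / gamma) *: (p - p') - delta *: (G p - G p').
Proof.
rewrite /S_op; have -> : 1 - (1 + delta / gamma) = - (delta / gamma) by ring.
by rewrite !scalerBr !opprD !opprK addrACA [X in X + _]addrACA.
Qed.

Lemma dr_step_ineqs x p q x' p' q' : dr_step x p q -> dr_step x' p' q' ->
  let r := (p - q) - (p' - q') in
  [/\ etastar / 2 * ip r r <= ip (x - x') r,
      gamma * sigma / 2 * ip (G p - G p') (G p - G p') <=
        ip (x - x') r + gamma / (2 * sigma) * ip r r
    & `|gamma * (alpha + beta) *: (p - p') - cross_coef *: r| ^+ 2 <=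
        gamma * (alpha + beta) * (ip (x - x') r + gamma / (4 * sigma) * ip r r)].
Proof.
move=> [px qx] [px' qx'] r.
have Qr : q - q' = (p - p') - r.
  by rewrite opprB addrA addrA subrK opprB addrC addrA subrK.
apply: splitting_ineqs.
- exact: (prox_monotone ipP pf lf cf gamma0 A0 px px').
- by rewrite -Qr -S_opB; exact: (prox_monotone ipP pg lg cg delta0 B0 qx qx').
- exact: (gradient_cocoercive ipP hG hcvx sigma0 GL).
Qed.

(** Divided by [delta], this says that the subgradient of [g] produced by a step with [q = p]
    cancels the subgradient of [f] plus the gradient. *)
Lemma S_op_sub x p :
  S_op gamma delta G p x - p = - (delta *: (gamma^-1 *: (x - p) + G p)).
Proof.
rewrite /S_op; have -> : 1 - (1 + delta / gamma) = - (delta / gamma) by ring.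
rewrite scalerDl scale1r scalerDr scalerA opprD addrAC; congr (_ - _).
rewrite addrCA addrC addKr scalerBr opprB scaleNr addrC //.
Qed.

Lemma dr_step_zer x p : dr_step x p p -> zer_sum ip f g G p.
Proof.
move=> [/(prox_subgradP ipP pf lf cf gamma0 A0) px /(prox_subgradP ipP pg lg cg delta0 B0) pq].
exists (gamma^-1 *: (x - p)), (delta^-1 *: (S_op gamma delta G p x - p)).
split; first exact/(frechet_subgradP ipP _ _ pf cf).
split; first exact/(frechet_subgradP ipP _ _ pg cg).
by rewrite S_op_sub scalerN scalerA mulVf // scale1r opprD addrA subrr sub0r addNr.
Qed.

Lemma zer_dr_step z : zer_sum ip f g G z -> exists x, dr_step x z z.
Proof.
move=> [u [v [/(frechet_subgradP ipP _ _ pf cf) fu [/(frechet_subgradP ipP _ _ pg cg) gv uv]]]].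
have xz : gamma^-1 *: (z + gamma *: u - z) = u.
  by rewrite addrAC subrr add0r scalerA mulVf // scale1r.
exists (z + gamma *: u); split.
  by apply/(prox_subgradP ipP pf lf cf gamma0 A0); rewrite xz.
apply/(prox_subgradP ipP pg lg cg delta0 B0).
rewrite S_op_sub scalerN scalerA mulVf // scale1r xz.
suff <- : v = - (u + G z) by [].
by apply/eqP; rewrite -addr_eq0 addrCA addrA uv.
Qed.

(** Add the two strong subgradient inequalities and the gradient inequality: linear terms cancel,
    and the quadratic remainder has coefficient [(alpha + beta) / 2 >= 0]. *)
Lemma zer_argmin z : zer_sum ip f g G z ->
  forall y, (f z + g z + (h z)%:E <= f y + g y + (h y)%:E)%E.
Proof.
move=> [u [v [/(frechet_subgradP ipP _ _ pf cf) [a fz hf]]]].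
move=> [/(frechet_subgradP ipP _ _ pg cg) [b gz hg] uv] y.
rewrite fz gz; have := hf y; have := hg y; have := gradient_ineq hG hcvx z y.
case fy : (f y) => [r| |]; last by have := pf.1 y; rewrite fy.
  case gy : (g y) => [s| |]; last by have := pg.1 y; rewrite gy.
    move=> hh /(_ s (lexx _)) hs /(_ r (lexx _)) hr.
    rewrite -!EFinD lee_fin.
    have : ip (u + v + G z) (y - z) = 0 by rewrite uv (ip0l ipP).
    rewrite !(ipDl ipP) => E0.
    have : 0 <= (alpha + beta) * `|y - z| ^+ 2.
      by rewrite mulr_ge0 ?sqr_ge0 //; case: cond => [[-> _ _ _]//|[/ltW]].
    lra.
  by rewrite addey // leey.
by case gy : (g y) => [s| |]; rewrite ?leey //; have := pg.1 y; rewrite gy.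
Qed.

(* Testing the two monotonicity inequalities at [pst] and at the point [b] below,
   where the choice delta = gamma / (1 + 2 gamma alpha) makes all terms quadratic
   in [p n] cancel. *)
Lemma perturbed_ineq (x P r c y b : X) : cond_a alpha beta sigma gamma delta etastar ->
  (1 + gamma * alpha) * ip P P <= ip x P ->
  (1 + delta * beta) * ip (P - r - b) (P - r - b) <=
    ip (- (delta / gamma) *: x + (1 + delta / gamma) *: P - delta *: c - y) (P - r - b) ->
  gamma / delta * ip y P <= ip x b + gamma / delta * ip y b
    + ip c (gamma *: (r - P + b))
    + ip r (x - A *: r - (2 * A) *: b + (gamma / delta) *: y).
Proof.
move=> /cond_aE[bE kE _] h1 h2.
have gd0 : 0 < gamma / delta by rewrite divr_gt0.
have := h2; rewrite -(ler_pM2l gd0) mulrA.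
(* Both quadratic coefficients are now [A], and the cross coefficient [gamma / delta + 1] is [2 A];
   this is the cancellation. *)
have -> : gamma / delta * (1 + delta * beta) = A.
  have -> : gamma / delta * (1 + delta * beta) = gamma / delta + gamma * beta by field.
  by rewrite kE bE /A; ring.
have -> : gamma / delta *
    ip (- (delta / gamma) *: x + (1 + delta / gamma) *: P - delta *: c - y) (P - r - b) =
    - ip x (P - r - b) + (gamma / delta + 1) * ip P (P - r - b)
     - gamma * ip c (P - r - b) - gamma / delta * ip y (P - r - b).
  by rewrite !(ipDl ipP) !(ipNl ipP) !(ipZl ipP); field; rewrite dneq; exact: gneq.
have Ab : 0 <= A * ip b b by rewrite mulr_ge0 ?(ip_ge0 ipP) // ltW.
move: h1; rewrite -/A.
have kA : gamma / delta = 2 * A - 1 by rewrite kE /A; ring.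
rewrite kA !(ipE ipP) (ipC ipP b P) (ipC ipP r P) (ipC ipP b r) (ipC ipP r x)
  (ipC ipP r y); lra.
Qed.

(** Perturb the input of the second prox at the limit by [t y], which moves its value by [b'].
    Dividing [perturbed_ineq] by [(gamma / delta) t] bounds [<y, p n - pst>] by [<y, b'>] plus a
    null sequence, and [<y, b'>] is small with [t]. *)
Lemma prox_weak_cvg xs p q xst pst : cond_a alpha beta sigma gamma delta etastar ->
  (forall n, dr_step (xs n) (p n) (q n)) -> dr_step xst pst pst ->
  weak_cvg ip xs xst -> eventually_bounded (fun n => xs n - xst) ->
  eventually_bounded (fun n => p n - pst) ->
  (fun n => p n - q n) @ \oo --> 0 -> (fun n => G (p n)) @ \oo --> G pst ->
  weak_cvg ip p pst.
Proof.
move=> ca steps [px pq] xw xb pb r0 c0.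
apply: (weak_cvg_half ipP) => y e e0.
have c0' : (fun n => G (p n) - G pst) @ \oo --> 0.
  by rewrite -(subrr (G pst)); apply: cvgB => //; exact: cvg_cst.
have y0 := ip_ge0 ipP y.
have y10 : 0 < ip y y + 1 by lra.
(* Chosen so that [<y, b'> <= t |y|^2 / (1 + delta beta) <= e / 2]; the [+ 1] covers [y = 0]. *)
pose t := e * (1 + delta * beta) / (2 * (ip y y + 1)).
have t0 : 0 < t by rewrite divr_gt0 ?mulr_gt0.
have [b qb] := prox_exists ipP pg lg cg delta0 B0 (S_op gamma delta G pst xst + t *: y).
have hb := prox_monotone ipP pg lg cg delta0 B0 qb pq.
rewrite addrAC subrr add0r in hb.
have [b' b'E] : exists b', b' = b - pst by exists (b - pst).
rewrite -b'E in hb.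
have yb : ip y b' <= e / 2.
  have := ip_ge0 ipP (t *: y - (1 + delta * beta) *: b').
  have := hb; rewrite -(ler_pM2l B0) => hb'.
  rewrite !(ipE ipP) (ipC ipP b' y) => sq.
  rewrite (ipZl ipP) in hb'.
  have : (1 + delta * beta) * (t * ip y b') <= t * (t * ip y y) by lra.
  rewrite mulrCA ler_pM2l // => h2.
  rewrite -(ler_pM2l B0); apply: (le_trans h2).
  have -> : t * ip y y = (1 + delta * beta) * (e / 2) * (ip y y / (ip y y + 1)).
    by rewrite /t; field; rewrite gt_eqF.
  by rewrite ler_piMr ?mulr_ge0 ?ltW // ?divr_gt0 // ltr_pdivrMr // mul1r; lra.
pose w n := ip (xs n - xst) b'
    + ip (G (p n) - G pst) (gamma *: ((p n - q n) - (p n - pst) + b'))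
    + ip (p n - q n) (xs n - xst - A *: (p n - q n) - (2 * A) *: b'
                      + (gamma / delta) *: (t *: y)).
have rb := eventually_bounded_cvg r0.
have w0 : w @ \oo --> 0.
  rewrite -[X in _ --> X]addr0 -[X in _ --> X + _]addr0.
  apply: cvgD; first apply: cvgD.
  - have lim0 : (fun n => ip (xs n) b' - ip xst b') @ \oo --> ip xst b' - ip xst b'.
      by apply: cvgB; [exact: xw | exact: cvg_cst].
    rewrite subrr in lim0; apply: cvg_trans lim0; apply: near_eq_cvg.
    by apply: nearW => n /=; rewrite !(ipE ipP).
  - apply: (ip_cvg0 ipP c0'); apply: eventually_boundedZ.
    apply: eventually_boundedD (eventually_bounded_cst _).
    apply: eventually_boundedD => //.
    have [M hM] := pb; exists M; apply: filterS hM => n; by rewrite normrN.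
  - apply: (ip_cvg0 ipP r0).
    apply: eventually_boundedD (eventually_bounded_cst _).
    apply: eventually_boundedD (eventually_bounded_cst _).
    apply: eventually_boundedD => //.
    have [M hM] := eventually_boundedZ A rb; exists M.
    by apply: filterS hM => n; rewrite normrN.
have k0 : 0 < gamma / delta by rewrite divr_gt0.
have ke : 0 < gamma / delta * (t * (e / 2)) by rewrite mulr_gt0 // mulr_gt0 // divr_gt0.
have /cvgrPdist_lt /(_ _ ke) near_w := w0; apply: filterS near_w => n /=.
rewrite sub0r normrN => /(le_lt_trans (ler_norm _)) wn.
have [pn qn] := steps n.
have Qb : q n - b = p n - pst - (p n - q n) - b'.
  have -> : p n - pst - (p n - q n) = q n - pst by rewrite opprB addrC addrA subrK.
  by rewrite b'E opprB addrA subrK.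
have := @perturbed_ineq (xs n - xst) (p n - pst) (p n - q n) (G (p n) - G pst)
  (t *: y) b' ca (prox_monotone ipP pf lf cf gamma0 A0 pn px).
rewrite -Qb -(S_opB (xs n) (p n) xst pst) -addrA -opprD => /(_ (prox_monotone ipP pg lg cg delta0 B0 qn qb)).
rewrite !(ipZl ipP) => ineq.
have kt0 : 0 < gamma / delta * t by rewrite mulr_gt0.
rewrite (ipC ipP) -(ltr_pM2l kt0).
have : gamma / delta * t * ip y b' <= gamma / delta * t * (e / 2) by rewrite ler_pM2l.
move: wn; rewrite /w; lra.
Qed.

End Steps.
End Splitting.

(** * Assembly of the convergence theorem *)

Theorem theorem6p2 (R : realType) (X : completeNormedModType R)
  (ip : X -> X -> R) (f g : X -> \bar R) (h : X -> R) (gradh : X -> X)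
  (alpha beta sigma gamma delta eta etastar : R) :
  inner_product ip ->
  proper_fun f -> lower_semicontinuous f -> alpha_convex alpha f ->
  proper_fun g -> lower_semicontinuous g -> alpha_convex beta g ->
  is_gradient ip h gradh -> convex_fun h ->
  0 < sigma -> lipschitz_with sigma^-1 gradh ->
  0 < gamma -> 0 < delta -> 0 < eta ->
  cond_a alpha beta sigma gamma delta etastar \/
    cond_b alpha beta sigma gamma delta etastar ->
  0 < etastar ->
  (* (i) *)
  ((forall x, exists! y, T_op gamma delta eta f g gradh x y) /\
   conically_averaged (eta / etastar) (T_op gamma delta eta f g gradh)) /\
  (* (ii) *)
  (forall xs : nat -> X,
     (forall n, T_op gamma delta eta f g gradh (xs n) (xs n.+1)) ->
     zer_sum ip f g gradh !=set0 -> eta < etastar ->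
     (fun n => Num.sqrt (n%:R) * `|xs n - xs n.+1|) @ \oo --> 0 /\
     exists xstar,
       T_op gamma delta eta f g gradh xstar xstar /\ weak_cvg ip xs xstar /\
       (exists pstar, prox gamma f xstar pstar) /\
       forall pstar, prox gamma f xstar pstar ->
         [/\ zer_sum ip f g gradh pstar,
             zer_sum ip f g gradh `<=`
               [set z | forall y, (f z + g z + (h z)%:E
                                   <= f y + g y + (h y)%:E)%E],
             gradh @` zer_sum ip f g gradh = [set gradh pstar],
             (forall qstar,
                prox delta g (S_op gamma delta gradh pstar xstar) qstar ->
                qstar = pstar)
           & forall p q : nat -> X,
               (forall n, prox gamma f (xs n) (p n)) ->
               (forall n, prox delta g (S_op gamma delta gradh (p n) (xs n)) (q n)) ->
               [/\ (fun n => gradh (p n)) @ \oo --> gradh pstar,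
                   cond_a alpha beta sigma gamma delta etastar ->
                     weak_cvg ip p pstar /\ weak_cvg ip q pstar
                 & cond_b alpha beta sigma gamma delta etastar ->
                     [/\ p @ \oo --> pstar, q @ \oo --> pstar
                       & zer_sum ip f g gradh = [set pstar]]]]).
Proof.
move=> ipP pf lf cf pg lg cg hG hcvx sigma0 GL gamma0 delta0 eta0 cond es0.
have [A0 B0] := resolvent_coef_gt0 sigma0 gamma0 delta0 es0 cond.
have ineqs := dr_step_ineqs ipP sigma0 gamma0 delta0 es0 cond pf lf cf pg lg cg hG hcvx GL.
have /choice[P PP] := prox_exists ipP pf lf cf gamma0 A0.
have /choice[Q QQ] : forall x, exists q, prox delta g (S_op gamma delta gradh (P x) x) q.
  by move=> x; exact: (prox_exists ipP pg lg cg delta0 B0).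
have Puniq x p : prox gamma f x p -> p = P x.
  by move=> xp; exact: (prox_uniq ipP pf lf cf gamma0 A0 xp (PP x)).
have Quniq x q : prox delta g (S_op gamma delta gradh (P x) x) q -> q = Q x.
  by move=> xq; exact: (prox_uniq ipP pg lg cg delta0 B0 xq (QQ x)).
have st x : dr_step gamma delta f g gradh x (P x) (Q x) by split.
have TE x y : T_op gamma delta eta f g gradh x y <-> y = x - eta *: P x + eta *: Q x.
  split=> [[p [q [/Puniq -> [/Quniq -> //]]]]|->]; by exists (P x), (Q x).
pose N x := x - etastar *: (P x - Q x).
have Nne : nonexpansive N.
  move=> x y; rewrite mul1r -(@ler_pXn2r _ 2%N) ?nnegrE //.
  have [h1 _ _] := ineqs _ _ _ _ _ _ (st x) (st y).
  have -> : N x - N y = (x - y) - etastar *: (P x - Q x - (P y - Q y)).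
    rewrite (scalerBr _ (P x - Q x)) /N !opprB.
    by rewrite addrACA [RHS]addrACA; congr (_ + _); exact: addrC.
  rewrite !(sqr_normE ipP); move: (P x - Q x - _) h1 => r h1.
  have := ler_wpM2l (ltW es0) h1.
  have -> : ip (x - y - etastar *: r) (x - y - etastar *: r) =
      ip (x - y) (x - y) - 2 * etastar * ip (x - y) r + etastar ^+ 2 * ip r r.
    by rewrite !(ipE ipP) (ipC ipP r x) (ipC ipP r y); ring.
  lra.
have TN x : x - eta *: P x + eta *: Q x =
    (1 - eta / etastar) *: x + (eta / etastar) *: N x.
  rewrite /N scalerBr scalerA divfK ?gt_eqF // addrA -scalerDl subrK scale1r.
  by rewrite scalerBr opprB [in RHS]addrA addrAC.
have FixN x : N x = x <-> P x = Q x.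
  rewrite /N; split=> [|->]; last by rewrite subrr scaler0 subr0.
  move/eqP; rewrite -subr_eq0 addrAC subrr sub0r oppr_eq0 scaler_eq0 gt_eqF //=.
  by rewrite subr_eq0 => /eqP.
split; [split|].
- move=> x; exists (x - eta *: P x + eta *: Q x); split; first exact/TE.
  by move=> y /TE.
- split; first exact: divr_gt0.
  exists N; split => // x; apply/seteqP; split=> y /=; first by move/TE ->.
  by move=> ->; apply/TE.
move=> xs xsT [z0 zer0] eta_lt.
have th0 : 0 < eta / etastar by rewrite divr_gt0.
have th1 : eta / etastar < 1 by rewrite ltr_pdivrMr // mul1r.
have xsS n : xs n.+1 = (1 - eta / etastar) *: xs n + (eta / etastar) *: N (xs n).
  by rewrite -TN; apply/TE.
have zer_step := zer_dr_step ipP sigma0 gamma0 delta0 es0 cond pf lf cf pg lg cg.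
have step_zer := dr_step_zer ipP sigma0 gamma0 delta0 es0 cond pf lf cf pg lg cg.
(* A zero of the sum supplies a point [w] with [P w = Q w], the fixed point of [N] needed by the
   iteration lemmas. *)
have [w [/Puniq zP +]] := zer_step _ _ zer0.
rewrite zP => /Quniq zQ.
have Nw : N w = w by apply/FixN.
split; first exact: (iterates_o ipP Nne th0 th1 xsS Nw).
have [xst Nxst xw] := iterates_weak_cvg ipP Nne th0 th1 xsS Nw.
have PQ := (FixN xst).1 Nxst.
exists xst; split; first by apply/TE; rewrite PQ subrK.
split=> //; split; first by exists (P xst).
move=> pst /Puniq pstE.
have stp : dr_step gamma delta f g gradh xst pst pst.
  by split; [rewrite pstE | rewrite {2}pstE PQ pstE].
(* Both zeros come from steps with [p = q], so [r = 0] and the second inequality bounds the squared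
   gradient difference by 0. *)
have gradE z : zer_sum ip f g gradh z -> gradh z = gradh pst.
  move=> /zer_step [x sz]; have [_ h2 _] := ineqs _ _ _ _ _ _ sz stp.
  move: h2; rewrite !subrr (ipC ipP _ 0) !(ip0l ipP) mulr0 addr0.
  rewrite pmulr_rle0 ?divr_gt0 ?mulr_gt0 // => h2; apply/eqP.
  by rewrite -subr_eq0 -normr_eq0 -sqrf_eq0 (sqr_normE ipP) eq_le h2 (ip_ge0 ipP).
split.
- exact: step_zer stp.
- by move=> z /(zer_argmin ipP cond pf cf pg cg hG hcvx).
- apply/seteqP; split=> [_ [z /gradE zE <-]|_ ->] //=.
  by exists pst => //; exact: step_zer stp.
- by move=> q; rewrite pstE => /Quniq ->.
move=> p q pn qn.
have stn n : dr_step gamma delta f g gradh (xs n) (p n) (q n) by split.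
have rE n : xs n - N (xs n) = etastar *: (p n - q n).
  rewrite /N opprB addrC subrK (Puniq _ _ (pn n)); congr (_ *: (_ - _)).
  by apply/esym/Quniq; rewrite -(Puniq _ _ (pn n)).
have r0 : (fun n => p n - q n) @ \oo --> 0.
  have -> : (fun n => p n - q n) = (fun n => etastar^-1 *: (xs n - N (xs n))).
    by apply/funext => n; rewrite rE scalerA mulVf ?scale1r // gt_eqF.
  rewrite -(scaler0 _ etastar^-1); apply: cvgZl_tmp.
  exact: (residual_cvg0 ipP Nne th0 th1 xsS Nxst).
have xb : eventually_bounded (fun n => xs n - xst).
  exists `|xs 0%N - xst|; apply: nearW; elim=> [//|n IHn]; apply: le_trans IHn.
  rewrite -(@ler_pXn2r _ 2%N) ?nnegrE //.
  apply: le_trans (fejer ipP Nne th0 xsS n Nxst) _; rewrite gerBl.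
  rewrite mulr_ge0 ?sqr_ge0 // mulr_ge0 // ?subr_ge0; exact: ltW.
have wit n := ineqs _ _ _ _ _ _ (stn n) stp.
(* Common form of the right-hand sides of the second and third step inequalities; it vanishes since
   [xs] is bounded and [p n - q n] tends to 0. *)
pose v (a : R) n := ip (xs n - xst) (p n - q n) + a * ip (p n - q n) (p n - q n).
have v0 a : v a @ \oo --> 0.
  rewrite -[X in _ --> X]addr0 -[X in _ --> _ + X](mulr0 a); apply: cvgD.
    have := ip_cvg0 ipP r0 xb; apply: cvg_trans; apply: near_eq_cvg.
    by apply: nearW => n; rewrite (ipC ipP).
  apply: cvgMl_tmp; exact: (ip_cvg0 ipP r0 (eventually_bounded_cvg r0)).
have gcv : (fun n => gradh (p n)) @ \oo --> gradh pst.
  have gs0 : 0 < gamma * sigma / 2 by rewrite divr_gt0 ?mulr_gt0.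
  apply: (cvg_sqr_dist (w := fun n => (gamma * sigma / 2)^-1 * v (gamma / (2 * sigma)) n)).
    move=> n; have [_ h2 _] := wit n; rewrite subrr subr0 in h2.
    by rewrite (sqr_normE ipP) ler_pdivlMl.
  by rewrite -[X in _ --> X](mulr0 (gamma * sigma / 2)^-1); apply: cvgMl_tmp.
split=> //.
- move=> ca.
  have pb : eventually_bounded (fun n => p n - pst).
    have [M hM] := xb; exists (M / (1 + gamma * alpha)); apply: filterS hM => n xM.
    rewrite ler_pdivlMr // mulrC.
    have hm := prox_monotone ipP pf lf cf gamma0 A0 (pn n) stp.1.
    have [->|pn0] := eqVneq (p n - pst) 0.
      by rewrite normr0 mulr0; apply: le_trans xM.
    apply: le_trans xM; rewrite -(@ler_pM2r _ `|p n - pst|) ?normr_gt0 //.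
    rewrite -mulrA -expr2 (sqr_normE ipP); apply: (le_trans hm); exact: ip_le_norm.
  have pw : weak_cvg ip p pst.
    exact: (prox_weak_cvg ipP sigma0 gamma0 delta0 es0 cond pf lf cf pg lg cg ca stn stp xw xb pb r0 gcv).
  split => //.
  have -> : q = (fun n => p n - (p n - q n)).
    by apply/funext => n; rewrite opprB addrC subrK.
  exact: weak_cvgB.
move=> [ab0 _]; set D := gamma * (alpha + beta) in wit.
have D0 : 0 < D by rewrite mulr_gt0.
have pcv : p @ \oo --> pst.
  pose k := cross_coef beta gamma delta.
  (* The third inequality controls this combination; since [p n - q n] tends to 0 and [D > 0], it
     determines the limit of [p]. *)
  have e0 : (fun n => D *: (p n - pst) - k *: (p n - q n)) @ \oo --> 0.
    apply: (cvg_sqr_dist (w := fun n => D * v (gamma / (4 * sigma)) n)).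
      by move=> n; have [_ _] := wit n; rewrite subrr !subr0.
    by rewrite -[X in _ --> X](mulr0 D); apply: cvgMl_tmp.
  have -> : p = (fun n => D^-1 *: (D *: (p n - pst) - k *: (p n - q n) + k *: (p n - q n)) + pst).
    by apply/funext => n; rewrite subrK scalerA mulVf ?gt_eqF // scale1r subrK.
  rewrite -[X in _ --> X]add0r; apply: cvgD; last exact: cvg_cst.
  rewrite -(scaler0 _ D^-1); apply: cvgZl_tmp; rewrite -[X in _ --> X]addr0.
  by apply: cvgD => //; rewrite -(scaler0 _ k); exact: cvgZl_tmp.
split=> //.
- have -> : q = (fun n => p n - (p n - q n)).
    by apply/funext => n; rewrite opprB addrC subrK.
  by rewrite -[X in _ --> X]subr0; apply: cvgB.
- apply/seteqP; split=> [z /zer_step [x sz]|_ ->] /=; last exact: step_zer stp.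
  have [_ _] := ineqs _ _ _ _ _ _ sz stp; rewrite -/D !subrr (ipC ipP _ 0) !(ip0l ipP).
  rewrite mulr0 addr0 mulr0 scaler0 subr0 => h3; apply/eqP.
  have : D *: (z - pst) == 0 by rewrite -normr_eq0 -sqrf_eq0 eq_le h3 sqr_ge0.
  by rewrite scaler_eq0 gt_eqF //= subr_eq0.
Qed.
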